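(* Let $\mathbf A\in\mathbb R^{I\times R}$, $\mathbf B\in\mathbb R^{J\times R}$, $\mathbf C\in\mathbb R^{K\times R}$ and let $\mathcal T=[\mathbf A,\mathbf B,\mathbf C]_R$. Suppose that $$k_{\mathbf A}+r_{\mathbf B}+k_{\mathbf C}\ge 2R+2\quad\text{and}\quad k_{\mathbf B}+k_{\mathbf C}\ge R+2.$$ Then $r_{\mathcal T}=R$ and the CPD of the tensor $\mathcal T$ is unique and can be found algebraically.
   Context: All matrices and tensors are real. For $\mathbf A=[\mathbf a_1\cdots\mathbf a_R]\in\mathbb R^{I\times R}$, $\mathbf B=[\mathbf b_1\cdots\mathbf b_R]\in\mathbb R^{J\times R}$, $\mathbf C=[\mathbf c_1\cdots\mathbf c_R]\in\mathbb R^{K\times R}$, $[\mathbf A,\mathbf B,\mathbf C]_R:=\sum_{r=1}^R\mathbf a_r\circ\mathbf b_r\circ\mathbf c_r\in\mathbb R^{I\times J\times K}$, where $(\mathbf a\circ\mathbf b\circ\mathbf c)_{ijk}=a_ib_jc_k$; for nonzero $\mathbf a,\mathbf b,\mathbf c$ this is a rank-1 tensor. The rank $r_{\mathcal T}$ of a tensor $\mathcal T$ is the minimal number of rank-1 tensors whose sum is $\mathcal T$; a decomposition of $\mathcal T$ into $r_{\mathcal T}$ rank-1 terms is a Canonical Polyadic Decomposition (CPD). The CPD is unique if it is unique up to permuting the rank-1 terms and rescaling the vectors inside a rank-1 term while keeping the term unchanged. $r_{\mathbf M}$ is the rank of a matrix $\mathbf M$; $k_{\mathbf M}$ (the $k$-rank)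 is the largest number such that every subset of $k_{\mathbf M}$ columns of $\mathbf M$ is linearly independent. ''The CPD can be found algebraically'' means: there is a procedure that is guaranteed to find the (exact) decomposition from $\mathcal T$ and relies only on standard linear algebra, namely basic operations on matrices (including solving linear systems and matrix factorizations), computing compound matrices (matrices of all minors of a given order), taking the orthogonal complement of a subspace, and computing generalized eigenvalue decompositions of matrix pencils; taking random (generic) linear combinations of slices is allowed. *)

(* Defs.v *)
From HB Require Import structures.
From mathcomp Require Import all_boot all_order all_fingroup all_algebra reals.
(* The notations of [mpoly] clash with those of mathcomp-analysis. *)
From mathcomp Require Import -(notations) mpoly.

Set Implicit Arguments.
Unset Strict Implicit.
Unset Printing Implicit Defensive.

Import GRing.Theory.
Local Open Scope ring_scope.

(** * Tensors and the Canonical Polyadic Decomposition *)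

Section Tensors.
Variables (F : realType) (I J K : nat).

Definition tensor := {ffun 'I_I * 'I_J * 'I_K -> F}.

Definition outer (a : 'cV[F]_I) (b : 'cV[F]_J) (c : 'cV[F]_K) : tensor :=
  [ffun ijk => a ijk.1.1 0 * b ijk.1.2 0 * c ijk.2 0].

Definition rank1_tensor (T : tensor) : Prop :=
  exists a b c, [/\ a != 0, b != 0, c != 0 & T = outer a b c].

Definition polyadic (R : nat) (A : 'M[F]_(I, R)) (B : 'M[F]_(J, R))
    (C : 'M[F]_(K, R)) : tensor :=
  \sum_(r < R) outer (col r A) (col r B) (col r C).

Definition sum_of_rank1 (T : tensor) (n : nat) : Prop :=
  exists2 t : 'I_n -> tensor,
    (forall r, rank1_tensor (t r)) & T = \sum_(r < n) t r.

Definition has_tensor_rank (T : tensor) (n : nat) : Prop :=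
  sum_of_rank1 T n /\ (forall m, sum_of_rank1 T m -> (n <= m)%N).

Definition is_cpd (T : tensor) (R : nat) (A : 'M[F]_(I, R)) (B : 'M[F]_(J, R))
    (C : 'M[F]_(K, R)) : Prop :=
  [/\ has_tensor_rank T R,
      forall r, rank1_tensor (outer (col r A) (col r B) (col r C))
    & T = polyadic A B C].

Definition same_cpd (R : nat)
    (A : 'M[F]_(I, R)) (B : 'M[F]_(J, R)) (C : 'M[F]_(K, R))
    (A' : 'M[F]_(I, R)) (B' : 'M[F]_(J, R)) (C' : 'M[F]_(K, R)) : Prop :=
  exists (s : 'S_R) (alpha beta gamma : 'I_R -> F),
    forall r : 'I_R,
      [/\ alpha r * beta r * gamma r = 1,
          col r A' = alpha r *: col (s r) A,
          col r B' = beta r *: col (s r) B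
        & col r C' = gamma r *: col (s r) C].

Definition cpd_unique (T : tensor) : Prop :=
  forall (R : nat)
    (A : 'M[F]_(I, R)) (B : 'M[F]_(J, R)) (C : 'M[F]_(K, R))
    (A' : 'M[F]_(I, R)) (B' : 'M[F]_(J, R)) (C' : 'M[F]_(K, R)),
    is_cpd T A B C -> is_cpd T A' B' C' -> same_cpd A B C A' B' C'.

End Tensors.

(** * k-rank and compound matrices *)

Definition columns_free (F : fieldType) (m n : nat) (M : 'M[F]_(m, n))
    (S : {set 'I_n}) : bool :=
  \rank (colsub (fun i : 'I_#|S| => enum_val i) M) == #|S|.

(* A value above [n] would satisfy the condition vacuously, whence the bound. *)
Definition krank (F : fieldType) (m n : nat) (M : 'M[F]_(m, n)) : nat :=
  (\max_(k < n.+1 |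
      [forall S : {set 'I_n}, (#|S| == k) ==> columns_free M S]) k)%N.

(* The [k]-element subsets of ['I_m], as increasing sequences. *)
Definition ksub (k m : nat) : predArgType :=
  {f : {ffun 'I_k -> 'I_m} |
    [forall i : 'I_k, forall j : 'I_k, (i < j)%N ==> (f i < f j)%N]}.

Definition compound (F : comNzRingType) (k m n : nat) (M : 'M[F]_(m, n)) :
    'M[F]_(#|{: ksub k m}|, #|{: ksub k n}|) :=
  \matrix_(i < #|{: ksub k m}|, j < #|{: ksub k n}|)
    \det (mxsub (sval (enum_val i)) (sval (enum_val j)) M).

(** * Algebraic procedures

  A procedure for [I x J x K] tensors is a finite tree of linear algebra
  instructions acting on matrix registers. A register of size [m x n] is named
  by the triple [(m, n, x)]. The syntax contains no real number: all real data
  come from the input tensor (read through its frontal slices), from integer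
  constants, and from the random coefficients. *)

Inductive expr (I J K : nat) : nat -> nat -> Type :=
| Reg m n (x : nat) : expr I J K m n
| Slice (k : 'I_K) : expr I J K I J
| Const m n (M : 'M[int]_(m, n)) : expr I J K m n
| Entry m n (e : expr I J K m n) (i : 'I_m) (j : 'I_n) : expr I J K 1 1
| Build m n (f : 'I_m -> 'I_n -> expr I J K 1 1) : expr I J K m n
| Add m n (e1 e2 : expr I J K m n) : expr I J K m n
| Scale m n (a : expr I J K 1 1) (e : expr I J K m n) : expr I J K m n
| Mul m n p (e1 : expr I J K m n) (e2 : expr I J K n p) : expr I J K m p
| Tr m n (e : expr I J K m n) : expr I J K n m
| Compound k m n (e : expr I J K m n) :
    expr I J K #|{: ksub k m}| #|{: ksub k n}|.

(* Where an instruction has two continuations, the first is taken when the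
   operation is possible (for [IfZero]: when the matrix vanishes). *)
Inductive procedure (I J K : nat) : Type :=
| Return N (a : expr I J K I N) (b : expr I J K J N) (c : expr I J K K N)
| Assign m n (x : nat) (e : expr I J K m n) (p : procedure I J K)
| IfZero m n (e : expr I J K m n) (p q : procedure I J K)
| Solve m n l (x : nat) (a : expr I J K m n) (b : expr I J K m l)
    (p q : procedure I J K)
| Factor m n (d x y : nat) (e : expr I J K m n) (p q : procedure I J K)
| OrthCompl n m (d x : nat) (e : expr I J K n m) (p q : procedure I J K)
| Gevd n (x y : nat) (a b : expr I J K n n) (p q : procedure I J K)
| RandomComb l m n (x : nat) (es : 'I_l -> expr I J K m n)
    (p : procedure I J K).

Section Semantics.
Variables (F : realType) (I J K : nat).

Definition store := forall m n : nat, nat -> 'M[F]_(m, n).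

Definition empty_store : store := fun _ _ _ => 0.

(* [conform_mx B M] is [M] if its size is that of [B], and [B] otherwise. *)
Definition update (s : store) (m n x : nat) (M : 'M[F]_(m, n)) : store :=
  fun m' n' y => if y == x then conform_mx (s m' n' y) M else s m' n' y.

Definition slice (T : tensor F I J K) (k : 'I_K) : 'M[F]_(I, J) :=
  \matrix_(i, j) T (i, j, k).

Fixpoint eval (T : tensor F I J K) (s : store) (m n : nat)
    (e : expr I J K m n) : 'M[F]_(m, n) :=
  match e with
  | Reg m n x => s m n x
  | Slice k => slice T k
  | Const _ _ M => map_mx intr M
  | Entry _ _ e i j => (eval T s e i j)%:M
  | Build _ _ f => \matrix_(i, j) eval T s (f i j) 0 0
  | Add _ _ e1 e2 => eval T s e1 + eval T s e2
  | Scale _ _ a e => eval T s a 0 0 *: eval T s e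
  | Mul _ _ _ e1 e2 => eval T s e1 *m eval T s e2
  | Tr _ _ e => (eval T s e)^T
  | Compound k _ _ e => compound k (eval T s e)
  end.

(* A property holds for generic coefficients if it holds outside the zero set
   of some nonzero polynomial. *)
Definition generic (l : nat) (P : ('I_l -> F) -> Prop) : Prop :=
  exists f : mpoly l F, f != 0 /\ (forall t, meval t f != 0 -> P t).

Definition factors (m n d : nat) (M : 'M[F]_(m, n))
    (L : 'M[F]_(m, d)) (U : 'M[F]_(d, n)) : Prop :=
  [/\ M = L *m U, \rank L = d & \rank U = d].

(* The columns of [X] form a basis of the orthogonal complement of the column
   space of [M]. *)
Definition orth_compl (n m d : nat) (M : 'M[F]_(n, m)) (X : 'M[F]_(n, d)) :
    Prop :=
  [/\ M^T *m X = 0, \rank X = d & (\rank M + d = n)%N].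

Definition gevd (n : nat) (M N : 'M[F]_n) (X : 'M[F]_n) (d : 'rV[F]_n) : Prop :=
  [/\ N \in unitmx, X \in unitmx & M *m X = N *m X *m diag_mx d].

(* [guaranteed T Q p s]: whatever solution, factorization, basis or generalized
   eigenvectors the instructions deliver, and for generic coefficients in the
   random combinations, running [p] from store [s] on input [T] returns matrices
   satisfying [Q]. *)
Fixpoint guaranteed (T : tensor F I J K)
    (Q : forall N, 'M[F]_(I, N) -> 'M[F]_(J, N) -> 'M[F]_(K, N) -> Prop)
    (p : procedure I J K) (s : store) : Prop :=
  match p with
  | Return N a b c => Q N (eval T s a) (eval T s b) (eval T s c)
  | Assign m n x e p => guaranteed T Q p (update s x (eval T s e))
  | IfZero _ _ e p q =>
      (eval T s e = 0 -> guaranteed T Q p s) /\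
      (eval T s e <> 0 -> guaranteed T Q q s)
  | Solve m n l x a b p q =>
      let sol (X : 'M[F]_(n, l)) := eval T s a *m X = eval T s b in
      (forall X, sol X -> guaranteed T Q p (update s x X)) /\
      ((forall X, ~ sol X) -> guaranteed T Q q s)
  | Factor m n d x y e p q =>
      let sol (L : 'M[F]_(m, d)) (U : 'M[F]_(d, n)) :=
        factors (eval T s e) L U in
      (forall L U, sol L U ->
        guaranteed T Q p (update (update s x L) y U)) /\
      ((forall L U, ~ sol L U) -> guaranteed T Q q s)
  | OrthCompl n m d x e p q =>
      let sol (X : 'M[F]_(n, d)) := orth_compl (eval T s e) X in
      (forall X, sol X -> guaranteed T Q p (update s x X)) /\
      ((forall X, ~ sol X) -> guaranteed T Q q s)
  | Gevd n x y a b p q =>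
      let sol (X : 'M[F]_n) (d : 'rV[F]_n) :=
        gevd (eval T s a) (eval T s b) X d in
      (forall X d, sol X d ->
        guaranteed T Q p (update (update s x X) y d)) /\
      ((forall X d, ~ sol X d) -> guaranteed T Q q s)
  | RandomComb l m n x es p =>
      generic (fun t : 'I_l -> F =>
        guaranteed T Q p (update s x (\sum_(i < l) t i *: eval T s (es i))))
  end.

Definition finds_cpd (p : procedure I J K) (T : tensor F I J K) : Prop :=
  guaranteed T (fun N A B C => is_cpd T A B C) p empty_store.

End Semantics.

(* Main.v *)
(** Let k = k_C and n = R - k, and project the third mode to dimension k by an integer
  matrix Phi such that any k columns of C0 = Phi C are independent. For x in F^k, the
  contraction T(x) = A diag(x C0) B^T has rank at least min(n+2, |supp(x C0)|), since
  k_A + r_B and k_B are large enough; for x <> 0 this support has at least n+1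
  elements, with equality on one line pt(V) for each set V of n+1 columns.

  Uniqueness. A second decomposition with at most R terms has the same matrices T(x),
  hence R terms, and its lines of minimal support are the same. Writing h_V for the
  product of the linear forms given by the columns in V, every form of degree n+1 is
  determined by its values at the points pt(V), so the products h_V of the two
  decompositions are proportional. A linear form of one thus divides a product of
  linear forms of the other, which matches the columns of C0. The column a_r is then
  the only common direction of the column spaces of the T(pt(V)) with r in V.

  Algorithm. The minors of order n+2 of T(x) span the products h_U with |U| = n+2, and
  a functional on forms of degree n+2 that kills them is a combination of evaluations
  at the points pt(V). Multiplication by two linear forms turns the space of these
  functionals into a matrix pencil whose generalized eigenvectors yield the pt(V).
  The columns of A and B are again common directions of column (row) spaces of the
  T(pt(V)), and C solves a linear system. Every choice to be made (number of terms,
  projection, pencil, dimensions, matching of eigenvectors with columns) ranges over a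
  finite set and is found by exhaustive search. *)

Require Import Defs.
From mathcomp Require Import all_boot all_order all_fingroup all_algebra reals.
From mathcomp Require Import zify ring.

Set Implicit Arguments.
Unset Strict Implicit.
Unset Printing Implicit Defensive.

Import Order.TTheory GRing.Theory Num.Theory.
Local Open Scope ring_scope.

(** * Linear algebra of k-ranks *)

Lemma subset_between (T : finType) (A B : {set T}) k :
  A \subset B -> (#|A| <= k <= #|B|)%N ->
  exists S : {set T}, [/\ A \subset S, S \subset B & #|S| = k].
Proof.
move=> AB /andP[Ak]; elim: k Ak => [|k IH].
  by rewrite leqn0 => /eqP A0 _; exists A.
rewrite leq_eqVlt => /orP[/eqP Ak _|Ak kB]; first by exists A.
have [S [AS SB Sk]] := IH Ak (ltnW kB).
have /subsetPn[x xB xS] : ~~ (B \subset S).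
  by apply: contraL kB => /subset_leq_card; rewrite Sk -ltnNge ltnS.
exists (x |: S); split; first by rewrite (subset_trans AS) ?subsetUr.
  by rewrite subUset sub1set xB.
by rewrite cardsU1 xS Sk.
Qed.

Section FreeColumns.
Variables (F : fieldType) (m n : nat) (M : 'M[F]_(m, n)).

Lemma mulmx_supported (S : {set 'I_n}) (v : 'cV[F]_n) :
  (forall r, r \notin S -> v r 0 = 0) ->
  M *m v = colsub (fun i : 'I_#|S| => enum_val i) M *m
             rowsub (fun i : 'I_#|S| => enum_val i) v.
Proof.
move=> vS; apply/matrixP => i j; rewrite !mxE (bigID (mem S)) /=.
rewrite [X in _ + X]big1 ?addr0; last by move=> r /vS vr; rewrite ord1 vr mulr0.
rewrite (big_enum_val (fun r => M i r * v r j)).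
by apply: eq_bigr => l _; rewrite !mxE.
Qed.

Lemma supported_ext (S : {set 'I_n}) (u : 'cV[F]_#|S|) :
  exists2 v : 'cV[F]_n, (forall r, r \notin S -> v r 0 = 0) &
    rowsub (fun i : 'I_#|S| => enum_val i) v = u.
Proof.
exists (\sum_i u i 0 *: delta_mx (enum_val i) 0) => [r rS|].
  rewrite summxE big1 // => i _; rewrite !mxE.
  case: (eqVneq r (enum_val i)) rS => [->|_ _]; last by rewrite mulr0.
  by rewrite enum_valP.
apply/colP => i; rewrite mxE summxE (bigD1 i) //= big1 ?addr0.
  by rewrite !mxE !eqxx mulr1.
move=> j ji; rewrite !mxE (inj_eq enum_val_inj) eq_sym (negPf ji).
by rewrite mulr0.
Qed.

Lemma columns_freeP (S : {set 'I_n}) :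
  reflect (forall v : 'cV[F]_n, (forall r, r \notin S -> v r 0 = 0) ->
             M *m v = 0 -> v = 0)
          (columns_free M S).
Proof.
rewrite /columns_free; set f := fun i : 'I_#|S| => enum_val i.
rewrite -mxrank_tr; apply: (iffP idP) => [free v vS Mv0 | indep].
  have fv0 : (rowsub f v)^T = 0.
    apply: (row_free_inj free); rewrite mul0mx -trmx_mul -mulmx_supported // Mv0.
    by rewrite trmx0.
  apply/matrixP => r j; rewrite ord1 mxE; have [rS|/vS//] := boolP (r \in S).
  have /matrixP/(_ 0 (enum_rank_in rS r)) := fv0.
  by rewrite !mxE /f enum_rankK_in.
apply: inj_row_free => v vM.
have [z zS fz] := supported_ext v^T.
have : z = 0.
  apply: indep => //; apply/trmx_inj.
  by rewrite (mulmx_supported zS) fz trmx_mul trmxK vM trmx0.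
move=> z0; apply/trmx_inj; rewrite -fz z0.
by apply/matrixP => i j; rewrite !mxE.
Qed.

Lemma columns_freeS (S S' : {set 'I_n}) :
  S' \subset S -> columns_free M S -> columns_free M S'.
Proof.
move=> /subsetP sub /columns_freeP free; apply/columns_freeP => v vS'.
by apply: free => r rS; apply/vS'/negP => /sub; apply/negP.
Qed.

Lemma columns_free_dual (S : {set 'I_n}) (u : 'I_n -> F) :
  columns_free M S ->
  exists y : 'rV[F]_m, {in S, forall r, (y *m M) 0 r = u r}.
Proof.
move=> /row_fullP[L LM].
exists (\row_i u (enum_val i) *m L) => r rS.
have -> : (\row_i u (enum_val i) *m L *m M) 0 r =
  (\row_i u (enum_val i) *m (L *m colsub (fun i : 'I_#|S| => enum_val i) M)) 0
    (enum_rank_in rS r).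
  rewrite mulmxA !mxE; apply: eq_bigr => i _.
  by congr (_ * _); rewrite mxE enum_rankK_in.
by rewrite LM mulmx1 mxE enum_rankK_in.
Qed.

(** A maximal free set containing [S] works: by maximality its columns span the column space of
    [M]. *)
Lemma columns_free_rank (S : {set 'I_n}) :
  columns_free M S ->
  exists W : {set 'I_n},
    [/\ S \subset W, columns_free M W & (\rank M <= #|W|)%N].
Proof.
move=> freeS; have [W /maxsetP[freeW maxW] SW] := maxset_exists freeS.
exists W; split=> //; pose f := fun i : 'I_#|W| => enum_val i.
suff : (M^T <= (colsub f M)^T)%MS.
  by move=> /mxrankS; rewrite !mxrank_tr => /leq_trans; apply; apply: rank_leq_col.
apply/row_subP => r.
have subW (z : 'cV[F]_n) : (forall s, s \notin W -> z s 0 = 0) ->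
    ((M *m z)^T <= (colsub f M)^T)%MS.
  by move=> /mulmx_supported ->; rewrite trmx_mul submxMl.
have [rW|rW] := boolP (r \in W).
  rewrite -tr_col colE; apply: subW => s sW.
  by rewrite mxE; case: (eqVneq s r) sW => [->|]; rewrite ?rW.
apply: contraT => nsub.
have /maxW/(_ (subsetUr _ _)) E : columns_free M (r |: W).
  apply/columns_freeP => v vS Mv0.
  have [vr0|vr0] := eqVneq (v r 0) 0.
    move/columns_freeP: freeW; apply => // s sW.
    by have [->//|sr] := eqVneq s r; apply: vS; rewrite !inE negb_or sr.
  case/negP: nsub; pose z := delta_mx r 0 - (v r 0)^-1 *: v.
  rewrite -tr_col colE; have -> : M *m delta_mx r (0 : 'I_1) = M *m z.
    by rewrite mulmxBr -scalemxAr Mv0 scaler0 subr0.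
  apply: subW => s sW; rewrite !mxE; have [->|sr] := eqVneq s r.
    by rewrite mulVf // subrr.
  have -> : v s 0 = 0 by apply: vS; rewrite !inE negb_or sr.
  by rewrite mulr0 subr0.
by case/negP: rW; rewrite -E setU11.
Qed.

Lemma krank_leq : (krank M <= n)%N.
Proof. by apply/bigmax_leqP => i _; rewrite -ltnS. Qed.

Lemma krank_columns_free (S : {set 'I_n}) :
  (#|S| <= krank M)%N -> columns_free M S.
Proof.
pose P (k : 'I_n.+1) :=
  [forall S : {set 'I_n}, (#|S| == k) ==> columns_free M S].
(* The value 0 always qualifies, so the maximum defining [krank] is attained. *)
have P0 : P ord0.
  apply/forallP => S'; apply/implyP => /eqP/cards0_eq ->.
  apply/columns_freeP => v v0 _; apply/matrixP => i j.
  by rewrite ord1 v0 ?inE // mxE.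
have [k Pk kE] : exists2 k : 'I_n.+1, P k & krank M = k.
  have [|k Pk kE] := @eq_bigmax_cond _ P (fun k => k : nat).
    by apply/card_gt0P; exists ord0.
  by exists k.
rewrite kE => Sk.
have [|S' [SS' _ S'k]] := @subset_between _ S setT k (subsetT _).
  by rewrite Sk cardsT card_ord -ltnS ltn_ord.
by apply: columns_freeS SS' _; move/forallP/(_ S')/implyP: Pk => ->; rewrite ?S'k.
Qed.

Lemma krank_leq_row : (krank M <= m)%N.
Proof.
have [|S [_ _ Sk]] := @subset_between _ set0 setT (krank M) (sub0set [set: 'I_n]).
  by rewrite cards0 cardsT card_ord krank_leq.
have : columns_free M S by apply: krank_columns_free; rewrite Sk.
move=> /eqP rS; rewrite -Sk -[X in (X <= _)%N]rS; exact: rank_leq_row.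
Qed.

Lemma krank_col_neq0 r : (0 < krank M)%N -> col r M != 0.
Proof.
move=> M0; apply/negP => /eqP Mr0; have : columns_free M [set r].
  by apply: krank_columns_free; rewrite cards1.
move=> /columns_freeP/(_ (delta_mx r 0)); rewrite -colE Mr0 => H.
have : delta_mx r 0 = 0 :> 'cV[F]_n.
  by apply: H => // r'; rewrite inE mxE => /negPf ->.
by move/matrixP/(_ r 0); rewrite !mxE !eqxx => /eqP; rewrite oner_eq0.
Qed.

End FreeColumns.

(** * Ranks and minors of the contracted matrices *)

Section DualFamilies.
Variables (F : fieldType) (I J R : nat) (A : 'M[F]_(I, R)) (B : 'M[F]_(J, R)).

(** For [w = y *m C] this is the contraction of the third mode of [polyadic A B C] with [y]. *)
Definition core (w : 'rV[F]_R) : 'M[F]_(I, J) := A *m diag_mx w *m B^T.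

Lemma coreE w i j : core w i j = \sum_r A i r * w 0 r * B j r.
Proof.
rewrite mxE; apply: eq_bigr => r _.
by rewrite mul_mx_diag !mxE.
Qed.

Lemma bilinear_core (x : 'rV[F]_I) (y : 'rV[F]_J) w :
  (x *m core w *m y^T) 0 0 =
  \sum_r (x *m A) 0 r * w 0 r * (y *m B) 0 r.
Proof.
rewrite /core !mulmxA -mulmxA -trmx_mul mul_mx_diag mxE.
by apply: eq_bigr => r _; rewrite [RHS]mulrC !mxE mulrC.
Qed.

(* Columns of [B] in [U] are completed to a basis [W] of its column space; the
   [y u] are dual to [W], the [x u] are dual to the columns of [A] indexed by
   the complement of [W] together with [U]. *)
Lemma dual_families (U : {set 'I_R}) :
  (#|U| <= krank B)%N -> (R + #|U| <= krank A + \rank B)%N ->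
  exists (x : 'I_R -> 'rV[F]_I) (y : 'I_R -> 'rV[F]_J),
    {in U &, forall u u' r,
       (x u *m A) 0 r * (y u' *m B) 0 r = ((r == u) && (r == u'))%:R}.
Proof.
move=> /krank_columns_free/columns_free_rank[W [UW freeW rW]] RU.
have freeW' : columns_free A (U :|: ~: W).
  apply: krank_columns_free; apply: leq_trans (leq_card_setU _ _).1 _.
  by have := cardsC W; rewrite card_ord => ?; lia.
have [x xE] := fin_all_exists (fun u => columns_free_dual (fun r => (r == u)%:R) freeW').
have [y yE] := fin_all_exists (fun u => columns_free_dual (fun r => (r == u)%:R) freeW).
exists x, y => u u' uU u'U r; have [rW'|rW'] := boolP (r \in W).
  rewrite yE //; have [->|ru] := eqVneq r u'; last by rewrite andbF mulr0.
  by rewrite mulr1 andbT xE // inE u'U.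
rewrite xE; last by rewrite !inE rW' orbT.
have -> : r == u = false by apply: contraNF rW' => /eqP ->; apply: (subsetP UW).
by rewrite mul0r.
Qed.

Lemma bilinear_core_dual (U : {set 'I_R}) (x : 'I_R -> 'rV[F]_I) (y : 'I_R -> 'rV[F]_J) w :
  {in U &, forall u u' r,
     (x u *m A) 0 r * (y u' *m B) 0 r = ((r == u) && (r == u'))%:R} ->
  {in U &, forall u u', (x u *m core w *m (y u')^T) 0 0 = w 0 u *+ (u == u')}.
Proof.
move=> xy u u' uU u'U; rewrite bilinear_core (bigD1 u) //= big1 ?addr0.
  by rewrite mulrAC xy // eqxx /= mulr_natl.
by move=> r ru; rewrite mulrAC xy // (negPf ru) mul0r.
Qed.

(** The rows of [X] and [Y] are families dual to [U], which makes the product diagonal. Expanding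
    the determinant, each product of [m] coordinates of [w] is thus a combination of minors of
    [core w]. *)
Lemma det_core (U : {set 'I_R}) m :
  #|U| = m -> (m <= krank B)%N -> (R + m <= krank A + \rank B)%N ->
  exists (X : 'M[F]_(m, I)) (Y : 'M[F]_(m, J)),
    forall w, \det (X *m core w *m Y^T) = \prod_(r in U) w 0 r.
Proof.
case: m / => kB kA; have [x [y xy]] := dual_families kB kA.
exists (\matrix_i x (enum_val i)), (\matrix_i y (enum_val i)) => w.
rewrite (big_enum_val (fun r => w 0 r)).
pose d : 'rV_#|U| := \row_i w 0 (enum_val i).
have -> : \prod_(i < #|U|) w 0 (enum_val i) = \prod_i d 0 i.
  by apply: eq_bigr => i _; rewrite mxE.
rewrite -det_diag; congr (\det _); apply/matrixP => i j.
have -> : (\matrix_i x (enum_val i) *m core w *m (\matrix_i y (enum_val i))^T) i j =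
    (x (enum_val i) *m core w *m (y (enum_val j))^T) 0 0.
  rewrite !mxE; apply: eq_bigr => l _; rewrite !mxE; congr (_ * _).
  by apply: eq_bigr => l' _; rewrite !mxE.
rewrite (bilinear_core_dual _ xy) ?enum_valP // !mxE.
by rewrite (inj_eq enum_val_inj).
Qed.

Lemma rank_core (U : {set 'I_R}) (w : 'rV[F]_R) :
  (#|U| <= krank B)%N -> (R + #|U| <= krank A + \rank B)%N ->
  {in U, forall r, w 0 r != 0} -> (#|U| <= \rank (core w))%N.
Proof.
move=> kB kA w0; have [X [Y detE]] := det_core erefl kB kA.
have : X *m core w *m Y^T \in unitmx.
  by rewrite unitmxE detE unitfE; apply/prodf_neq0 => r /w0.
rewrite -row_full_unit => /eqP E; rewrite -[leqLHS]E.
exact: leq_trans (mxrankM_maxl _ _) (mxrankM_maxr _ _).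
Qed.

Lemma core_supp (w : 'rV[F]_R) :
  let f (i : 'I_#|[set r | (w 0 r != 0)%R]|) := enum_val i in
  core w = colsub f A *m rowsub f (diag_mx w *m B^T).
Proof.
set U := [set r | _] => f.
apply/matrixP => i j; rewrite coreE mxE (bigID (mem U)) /=.
rewrite [X in _ + X]big1 ?addr0.
  rewrite (big_enum_val (fun r => A i r * w 0 r * B j r)).
  by apply: eq_bigr => r _; rewrite mxE mxE mul_diag_mx !mxE mulrA.
by move=> r; rewrite inE negbK => /eqP ->; rewrite mulr0 mul0r.
Qed.

Lemma rank_core_leq (w : 'rV[F]_R) : (\rank (core w) <= #|[set r | (w 0 r != 0)%R]|)%N.
Proof.
by rewrite core_supp; apply: leq_trans (mxrankM_maxl _ _) (rank_leq_col _).
Qed.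

End DualFamilies.

(** * Integer points off finitely many hyperplanes *)

Definition moment (F : pzSemiRingType) K (t : nat) : 'rV[F]_K := \row_b t%:R ^+ b.

(** Along the moment curve each [v x] becomes a nonzero polynomial of size at most [K], and the
    product of these has at most [#|X| * K] roots. The range of [t] does not depend on [v], so [t]
    can be found by exhaustive search. *)
Lemma moment_avoid (F : numFieldType) (X : finType) (P : pred X) K
    (v : X -> 'cV[F]_K) :
  (forall x, P x -> v x != 0) ->
  exists t : 'I_(#|X| * K).+1,
    forall x, P x -> (moment F K t *m v x) 0 0 != 0.
Proof.
move=> v0; pose p x := rVpoly (v x)^T.
have pE x (t : nat) : (p x).[t%:R] = (moment F K t *m v x) 0 0.
  rewrite /p /rVpoly horner_poly mxE; apply: eq_bigr => b _.
  by rewrite insubT // => ?; rewrite !mxE mulrC; congr (_ * v x _ _); apply/val_inj.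
pose q := \prod_(x | P x) p x.
have q0 : q != 0.
  apply/prodf_neq0 => x /v0; apply: contraNneq => px0.
  by apply/eqP/trmx_inj; rewrite -[LHS]rVpolyK -/(p x) px0 linear0 trmx0.
have sq : (size q <= (#|X| * K).+1)%N.
  apply: leq_trans (size_prod_leq _ _) _.
  rewrite leq_subLR addnS ltnS; apply: leq_trans (leq_addl _ _).
  apply: leq_trans (_ : \sum_(x | P x) K <= _)%N.
    by apply: leq_sum => x _; apply: size_poly.
  by rewrite sum_nat_const leq_mul2r max_card orbT.
pose rs : seq F := [seq (t : nat)%:R | t : 'I_(#|X| * K).+1].
have urs : uniq rs.
  by rewrite map_inj_uniq ?enum_uniq // => s t /eqP; rewrite eqr_nat => /eqP/val_inj.
have : ~~ all (root q) rs.
  apply/negP => /(max_poly_roots q0)/(_ urs).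
  by rewrite size_map size_enum_ord ltnNge sq.
case/allPn => _ /mapP[t _ ->]; rewrite /root /q horner_prod => /prodf_neq0 qt.
by exists t => x Px; rewrite -pE qt.
Qed.

(** * Hyperplanes in general position *)

(** Equivalently, any [k] columns of [C] are independent. The dual form counts the zeros of
    [x *m C], whose support governs the rank of [core]. *)
Definition general_position (F : fieldType) k R (C : 'M[F]_(k, R)) : Prop :=
  forall x : 'rV[F]_k, x != 0 -> (#|[set r | ((x *m C) 0 r == 0)%R]| < k)%N.

Lemma rank_lt_ker (F : fieldType) m n (N : 'M[F]_(m, n)) :
  (\rank N < m)%N -> exists2 x : 'rV[F]_m, x != 0 & x *m N = 0.
Proof.
move=> rN; have /rowV0Pn[x /sub_kermxP xN x0] : kermx N != 0.
  by rewrite -mxrank_eq0 mxrank_ker subn_eq0 -ltnNge.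
by exists x.
Qed.

Section GeneralPosition.
Variables (F : fieldType) (k R : nat) (C : 'M[F]_(k, R)).

Lemma zero_point (S : {set 'I_R}) : (#|S| < k)%N ->
  exists2 x : 'rV[F]_k, x != 0 & {in S, forall r, (x *m C) 0 r = 0}.
Proof.
move=> Sk.
have [|x x0 xC] := @rank_lt_ker _ _ _ (colsub (fun i : 'I_#|S| => enum_val i) C).
  by apply: leq_ltn_trans Sk; apply: rank_leq_col.
exists x => // r rS; have /matrixP/(_ 0 (enum_rank_in rS r)) := xC.
rewrite !mxE => E; rewrite -[RHS]E; apply: eq_bigr => i _.
by rewrite mxE enum_rankK_in.
Qed.

Lemma card_zeros_supp (x : 'rV[F]_k) :
  (#|[set r | ((x *m C) 0 r == 0)%R]| + #|[set r | ((x *m C) 0 r != 0)%R]|)%N = R.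
Proof.
rewrite -[RHS]card_ord -(cardsC [set r | ((x *m C) 0 r == 0)%R]).
by congr (_ + #|pred_of_set _|)%N; apply/setP => r; rewrite !inE.
Qed.

Lemma supp_general_position n : (R <= k + n)%N ->
  (forall x : 'rV[F]_k, x != 0 -> (n < #|[set r | ((x *m C) 0 r != 0)%R]|)%N) ->
  general_position C.
Proof. by move=> Rkn nC x /nC; have := card_zeros_supp x; lia. Qed.

Hypothesis gpC : general_position C.

Lemma gp_supp n (x : 'rV[F]_k) : (k + n <= R)%N -> x != 0 ->
  (n < #|[set r | ((x *m C) 0 r != 0)%R]|)%N.
Proof. by move=> Rkn /gpC; have := card_zeros_supp x; lia. Qed.

Lemma gp_vanish (S : {set 'I_R}) (x : 'rV[F]_k) :
  (k <= #|S|)%N -> {in S, forall r, (x *m C) 0 r = 0} -> x = 0.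
Proof.
move=> kS xS; apply: contraTeq kS => /gpC; rewrite -ltnNge; apply: leq_ltn_trans.
by apply/subset_leq_card/subsetP => r /xS; rewrite inE => ->.
Qed.

Lemma gp_span (S : {set 'I_R}) (c : 'cV[F]_k) :
  (k <= #|S|)%N -> exists b : 'I_R -> F, c = \sum_(r in S) b r *: col r C.
Proof.
move=> kS; pose f (i : 'I_#|S|) := enum_val i.
have /row_freeP[B CB] : row_free (colsub f C).
  apply: inj_row_free => x xC; apply: (gp_vanish kS) => r rS.
  have /matrixP/(_ 0 (enum_rank_in rS r)) := xC.
  rewrite !mxE => E; rewrite -[RHS]E; apply: eq_bigr => i _.
  by rewrite mxE /f enum_rankK_in.
have [v vS fv] := supported_ext (B *m c); exists (fun r => v r 0).
have -> : c = C *m v by rewrite (mulmx_supported C vS) fv mulmxA CB mul1mx.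
apply/colP => i; rewrite summxE mxE (bigID (mem S)) /= [X in _ + X]big1 ?addr0.
  by apply: eq_bigr => r _; rewrite !mxE mulrC.
by move=> r /vS ->; rewrite mulr0.
Qed.

Lemma gp_separate (S : {set 'I_R}) r :
  (k <= R)%N -> (#|S| < k)%N -> r \notin S ->
  exists2 x : 'rV[F]_k, {in S, forall s, (x *m C) 0 s = 0} & (x *m C) 0 r != 0.
Proof.
move=> kR Sk rS.
have [||S' [SS' S'r S'k]] := @subset_between _ S (~: [set r]) k.-1.
- by apply/subsetP => s sS; rewrite !inE; apply: contraNneq rS => <-.
- have := cardsC [set r]; rewrite cards1 card_ord; lia.
have [|x x0 xS'] := @zero_point S'; first by rewrite S'k; lia.
exists x => [s sS|]; first by rewrite xS' ?(subsetP SS').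
apply: contraNneq x0 => xr; apply/eqP; apply: (@gp_vanish (r |: S')).
  rewrite cardsU1 S'k; have -> : r \notin S'.
    by apply/negP => /(subsetP S'r); rewrite !inE eqxx.
  lia.
by move=> s; rewrite !inE => /orP[/eqP ->|/xS'].
Qed.

(** A nonzero [x] orthogonal to the [k.-1] columns outside [V] cannot be orthogonal to one more
    column. *)
Lemma gp_points n : R = (k + n)%N -> (0 < k)%N ->
  exists pt : {set 'I_R} -> 'rV[F]_k,
    forall V : {set 'I_R}, #|V| = n.+1 -> forall r, ((pt V *m C) 0 r == 0) = (r \notin V).
Proof.
move=> Rkn k0; pose P (V : {set 'I_R}) (x : 'rV[F]_k) :=
  #|V| = n.+1 -> forall r, ((x *m C) 0 r == 0) = (r \notin V).
apply: (@fin_all_exists _ _ P) => V.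
(* Every [V] needs a value; sets of the wrong size get 0. *)
have [Vn|Vn] := eqVneq #|V| n.+1; last by exists 0 => /eqP; rewrite (negPf Vn).
have cV : #|~: V| = k.-1 by have := cardsC V; rewrite card_ord; lia.
have [|x x0 xV] := @zero_point (~: V); first by rewrite cV; lia.
exists x => _ r; apply/eqP/idP => [xr|rV]; last by rewrite xV ?inE.
apply: contraTN (gpC x0) => rV; rewrite -leqNgt.
apply: leq_trans (_ : #|r |: ~: V| <= _)%N.
  by rewrite cardsU1 inE rV cV; lia.
apply/subset_leq_card/subsetP => s; rewrite !inE => /orP[/eqP ->|sV].
  by rewrite xr.
by rewrite xV ?inE.
Qed.

(** With [a] chosen so that [y - a *: x] vanishes at one [r] in [V], this vector has [k] zeros and
    is 0. *)
Lemma gp_point_uniq n (V : {set 'I_R}) (x y : 'rV[F]_k) :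
  R = (k + n)%N -> #|V| = n.+1 ->
  (forall r, ((x *m C) 0 r == 0) = (r \notin V)) ->
  {in ~: V, forall r, (y *m C) 0 r = 0} -> exists a, y = a *: x.
Proof.
move=> Rkn Vn xV yV.
have /card_gt0P[r rV] : (0 < #|V|)%N by rewrite Vn.
have xr : (x *m C) 0 r != 0 by rewrite xV rV.
exists ((y *m C) 0 r / (x *m C) 0 r); apply/eqP; rewrite -subr_eq0; apply/eqP.
apply: (@gp_vanish (r |: ~: V)).
  rewrite cardsU1 inE rV; have := cardsC V; rewrite card_ord; lia.
move=> s; set a := _ / _.
have -> : ((y - a *: x) *m C) 0 s = (y *m C) 0 s - a * (x *m C) 0 s.
  by rewrite mulmxBl -scalemxAl !mxE.
have [->|sr] := eqVneq s r; first by rewrite divfK ?subrr.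
rewrite in_setU1 (negPf sr) /= => sV; rewrite yV //.
by have := xV s; rewrite -in_setC sV => /eqP ->; rewrite mulr0 subr0.
Qed.

End GeneralPosition.

Definition vandermonde (F : pzSemiRingType) k K (t : 'I_k -> nat) : 'M[F]_(k, K) :=
  \matrix_(a, b) (t a)%:R ^+ b.

(** The rows of the projection are points of the moment curve, chosen one at a time. By [good i t],
    no nontrivial combination of the first [i] projected rows vanishes at [k] columns; [i = k] is
    general position. *)
Lemma gp_projection (F : numFieldType) K R k (C : 'M[F]_(K, R)) :
  (k <= krank C)%N ->
  exists t : {ffun 'I_k -> 'I_(#|{set 'I_R}| * K).+1},
    general_position (vandermonde F K (val \o t) *m C).
Proof.
move=> kC; set D := (#|{set 'I_R}| * K).+1.
pose good i (t : {ffun 'I_k -> 'I_D}) := forall (S : {set 'I_R}) (x : 'rV[F]_k),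
  #|S| = k -> (forall a : 'I_k, (i <= a)%N -> x 0 a = 0) ->
  {in S, forall r, (x *m (vandermonde F K (val \o t) *m C)) 0 r = 0} -> x = 0.
suff H i : (i <= k)%N -> exists t, good i t.
  have [t tgood] := H k (leqnn k); exists t => x x0.
  rewrite ltnNge; apply: contra x0 => kS.
  have [|S [_ SZ Sk]] := @subset_between _ set0 _ k (sub0set
      [set r | ((x *m (vandermonde F K (val \o t) *m C)) 0 r == 0)%R]).
    by rewrite cards0.
  apply/eqP; apply: (tgood S) => // [a|r /(subsetP SZ)]; last by rewrite inE => /eqP.
  by rewrite leqNgt ltn_ord.
elim: i => [_|i IH ik].
  by exists [ffun => ord0] => S x _ x0 _; apply/rowP => a; rewrite x0 ?mxE.
have [t tgood] := IH (ltnW ik).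
pose Phi := vandermonde F K (val \o t).
(* The first [i < k] rows, restricted to [S], have a kernel vector [v], and [C *m v != 0] since [k]
   columns of [C] are independent. The next row must not be orthogonal to [C *m v]. *)
have vP (S : {set 'I_R}) : exists v : 'cV[F]_R, #|S| = k ->
    [/\ C *m v != 0, forall r, r \notin S -> v r 0 = 0
      & forall a : 'I_k, (a < i)%N -> (Phi *m C *m v) a 0 = 0].
  have [Sk|Sk] := eqVneq #|S| k; last by exists 0 => /eqP; rewrite (negPf Sk).
  pose N : 'M[F]_(k, R) := pid_mx i *m (Phi *m C).
  have [|u u0 uN] := @rank_lt_ker _ _ _ (colsub (fun j : 'I_#|S| => enum_val j) N)^T.
    rewrite mxrank_tr -mulmx_colsub; apply: (@leq_ltn_trans i); last by rewrite Sk.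
    apply: leq_trans (mxrankM_maxl _ _) _.
    by rewrite rank_pid_mx // ltnW.
  have [v vS fv] := supported_ext u^T; exists v => _; split=> // [|a ai].
    apply: contraNneq u0 => Cv0; apply/eqP/trmx_inj; rewrite -fv.
    have /columns_freeP/(_ v vS Cv0) -> : columns_free C S.
      by apply: krank_columns_free; rewrite Sk.
    by apply/matrixP => ? ?; rewrite !mxE.
  have /matrixP/(_ a 0) : N *m v = 0.
    by apply/trmx_inj; rewrite (mulmx_supported N vS) fv trmx_mul trmxK uN trmx0.
  rewrite /N -mulmxA !mxE (bigD1 a) //= big1 ?addr0.
    by rewrite [pid_mx _ _ _]mxE eqxx ai mul1r mxE.
  move=> b ba; rewrite mxE; case: eqP => [/val_inj ab|_]; last by rewrite mul0r.
  by rewrite ab eqxx in ba.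
have [v vE] := fin_all_exists vP.
have [|t' t'P] := @moment_avoid _ _ (fun S : {set 'I_R} => #|S| == k) _ (fun S => C *m v S).
  by move=> S /eqP/vE[].
exists [ffun a => if a == Ordinal ik then t' else t a] => S x Sk xa xS.
have [Cv0 vS vPhi] := vE S Sk.
set Phi' := vandermonde _ _ _ in xS.
have xv : x *m Phi' *m C *m v S = 0.
  apply/matrixP => a b; rewrite !ord1 mxE mxE big1 // => r _.
  by have [/xS|/vS ->] := boolP (r \in S); rewrite ?mulr0 // mulmxA => ->; rewrite mul0r.
(* Pairing with [v S] kills the first [i] rows and leaves the new coordinate of [x] with a nonzero
   factor. *)
have xi : x 0 (Ordinal ik) = 0.
  have /matrixP/(_ 0 0) := xv; rewrite -2!mulmxA mxE (bigD1 (Ordinal ik)) //= big1.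
    rewrite addr0 [RHS]mxE => /eqP; rewrite mulf_eq0 => /orP[/eqP //|].
    move=> /eqP E; case/negP: (t'P S (introT eqP Sk)); apply/eqP; rewrite -[RHS]E !mxE.
    apply: eq_bigr => b _; by rewrite !mxE /= ffunE eqxx.
  move=> a aik; have [ia|ai] := leqP i.+1 a; first by rewrite xa ?mul0r.
  have ai' : (a < i)%N by move: aik; rewrite -val_eqE /= ; lia.
  have := vPhi a ai'; rewrite -mulmxA !mxE => E.
  rewrite -[RHS](mulr0 (x 0 a)) -[in RHS]E; congr (_ * _).
  by apply: eq_bigr => b _; rewrite !mxE /= ffunE (negPf aik).
apply: tgood Sk _ _ => [a|r rS].
  rewrite leq_eqVlt => /orP[/eqP ia|/xa //].
  by rewrite -[RHS]xi; congr (x _ _); apply/val_inj.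
rewrite -[RHS](xS r rS) !mulmxA; congr ((_ *m _) _ _).
apply/rowP => b; rewrite !mxE; apply: eq_bigr => a _; rewrite !mxE /= ffunE.
by case: eqP => // ->; rewrite xi !mul0r.
Qed.

(** * Forms and interpolation *)

Section Forms.
Variables (F : fieldType) (k : nat).
Implicit Types (g : 'rV[F]_k -> F).

Definition mono d (f : {ffun 'I_d -> 'I_k}) (x : 'rV[F]_k) : F :=
  \prod_i x 0 (f i).

(** Forms are kept as functions. Coefficients are indexed by sequences of variables, so the same
    monomial may occur several times. *)
Definition is_form d g :=
  exists a : {ffun 'I_d -> 'I_k} -> F, forall x, g x = \sum_f a f * mono f x.

Lemma form_ext d g g' : g =1 g' -> is_form d g -> is_form d g'.
Proof. by move=> gg' [a ga]; exists a => x; rewrite -gg'. Qed.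

Lemma form_mono d (f : {ffun 'I_d -> 'I_k}) : is_form d (mono f).
Proof.
exists (fun f' => (f' == f)%:R) => x; rewrite (bigD1 f) //= eqxx mul1r big1 ?addr0 //.
by move=> f' /negPf ->; rewrite mul0r.
Qed.

Lemma form_sum d (T : finType) (P : pred T) (g : T -> 'rV[F]_k -> F) :
  (forall i, P i -> is_form d (g i)) -> is_form d (fun x => \sum_(i | P i) g i x).
Proof.
move=> gP; have /fin_all_exists[a aE] : forall i, exists a, P i ->
    forall x, g i x = \sum_(f : {ffun 'I_d -> 'I_k}) a f * mono f x.
  move=> i; case Pi : (P i); last by exists (fun=> 0).
  by have [a ga] := gP i Pi; exists a.
exists (fun f => \sum_(i | P i) a i f) => x; under eq_bigr => i Pi do rewrite aE //.
by rewrite exchange_big; apply: eq_bigr => f _; rewrite mulr_suml.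
Qed.

Lemma form_scale d b g : is_form d g -> is_form d (fun x => b * g x).
Proof.
move=> [a ga]; exists (fun f => b * a f) => x.
by rewrite ga mulr_sumr; apply: eq_bigr => f _; rewrite mulrA.
Qed.

Definition linf (c : 'cV[F]_k) (x : 'rV[F]_k) : F := (x *m c) 0 0.

Lemma form_lin d (c : 'cV[F]_k) g :
  is_form d g -> is_form d.+1 (fun x => linf c x * g x).
Proof.
move=> [a ga].
pose cons i (f : {ffun 'I_d -> 'I_k}) : {ffun 'I_d.+1 -> 'I_k} :=
  [ffun j => if unlift ord0 j is Some j' then f j' else i].
have consE i f x : mono (cons i f) x = x 0 i * mono f x.
  rewrite /mono big_ord_recl ffunE unlift_none; congr (_ * _).
  by apply: eq_bigr => j _; rewrite ffunE liftK.
apply: (@form_ext _ (fun x =>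
    \sum_(i < k) c i 0 * \sum_f a f * mono (cons i f) x)) => [x|].
  rewrite /linf mxE mulr_suml; apply: eq_bigr => i _.
  rewrite ga !mulr_sumr; apply: eq_bigr => f _; rewrite consE.
  by ring.
apply: form_sum => i _; apply: form_scale; apply: form_sum => f _.
by apply: form_scale; apply: form_mono.
Qed.

Lemma form_prod (T : Type) (s : seq T) (c : T -> 'cV[F]_k) :
  is_form (size s) (fun x => \prod_(i <- s) linf (c i) x).
Proof.
elim: s => [|i s IH] /=.
  apply: form_ext (form_mono [ffun j : 'I_0 => False_rect _ (notF (valP j))]) => x.
  by rewrite /mono big_ord0 big_nil.
apply: form_ext (form_lin (c i) IH) => x; by rewrite big_cons.
Qed.

Lemma form_det d (M : 'I_d -> 'I_d -> 'cV[F]_k) :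
  is_form d (fun x => \det (\matrix_(i, j) linf (M i j) x)).
Proof.
rewrite /determinant.
apply: form_sum => s _; apply: form_scale.
have := form_prod (enum 'I_d) (fun i => M i (s i)); rewrite size_enum_ord.
by apply: form_ext => x; rewrite big_enum; apply: eq_bigr => i _; rewrite mxE.
Qed.

End Forms.

(** Lagrange interpolation at the nodes [0..d] in each coordinate; the coefficient of a grid point
    is the product over the coordinates. *)
Lemma grid_functional (F : numFieldType) k d (x : 'rV[F]_k) :
  exists l : {ffun 'I_k -> 'I_d.+1} -> F, forall g, is_form d g ->
    g x = \sum_p l p * g (\row_a (p a)%:R).
Proof.
have univ y : exists L : 'I_d.+1 -> F, forall e, (e <= d)%N ->
    y ^+ e = \sum_t L t * (t : nat)%:R ^+ e.
  pose V : 'M[F]_d.+1 := Vandermonde d.+1 (\row_t (t : nat)%:R).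
  have Vu : V \in unitmx.
    rewrite unitmxE det_Vandermonde unitfE; apply/prodf_neq0 => i _.
    apply/prodf_neq0 => j ij; rewrite !mxE subr_eq0 eqr_nat.
    by rewrite gtn_eqF.
  exists (fun t => (invmx V *m \col_e y ^+ e) t 0) => e ed.
  have /matrixP/(_ (Ordinal (ed : e < d.+1)%N) 0) := mulKVmx Vu (\col_e y ^+ e).
  rewrite [RHS]mxE => <-; rewrite [LHS]mxE; apply: eq_bigr => t _.
  by rewrite [V _ _]mxE mulrC !mxE.
have [L LE] := fin_all_exists (fun a => univ (x 0 a)).
exists (fun p => \prod_a L a (p a)) => g [c gE]; rewrite gE.
under [RHS]eq_bigr => p _ do rewrite gE mulr_sumr.
rewrite exchange_big; apply: eq_bigr => f _ /=.
have monoE (y : 'rV[F]_k) : mono f y = \prod_a y 0 a ^+ #|[set i | f i == a]|.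
  rewrite /mono (partition_big f xpredT) //=; apply: eq_bigr => a _.
  rewrite -prodr_const; apply: eq_big => [i|i /eqP -> //]; by rewrite inE.
rewrite monoE; under [RHS]eq_bigr => p _ do rewrite monoE mulrCA.
rewrite -mulr_sumr; congr (_ * _).
under eq_bigr => a _.
  (* A variable occurs at most [d] times in a monomial of degree [d]. *)
  rewrite LE; last by rewrite -[X in (_ <= X)%N](card_ord d) max_card.
  over.
rewrite bigA_distr_bigA; apply: eq_bigr => p _.
by rewrite -big_split; apply: eq_bigr => a _; rewrite mxE.
Qed.

Section Interpolation.
Variables (F : fieldType) (k R n : nat) (C : 'M[F]_(k, R)).
Hypotheses (gpC : general_position C) (Rkn : R = (k + n)%N) (k0 : (0 < k)%N).

Definition hprod (V : {set 'I_R}) (x : 'rV[F]_k) : F :=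
  \prod_(r in V) (x *m C) 0 r.

Lemma mul_col (x : 'rV[F]_k) r : (x *m C) 0 r = linf (col r C) x.
Proof. by rewrite /linf !mxE; apply: eq_bigr => i _; rewrite mxE. Qed.

Lemma form_hprod (V : {set 'I_R}) : is_form #|V| (hprod V).
Proof.
have := form_prod (enum V) (fun r => col r C); rewrite -cardE.
apply: form_ext => x; rewrite /hprod big_enum.
by apply: eq_bigr => r _; rewrite mul_col.
Qed.

(* Induction on [d]: a linear form times [hprod C V] is a combination of the
   [hprod C (r |: V)], as the [k] columns of [C] in [U :\: V] span all linear forms. *)
Lemma form_span d (U : {set 'I_R}) g :
  (k + d = #|U|.+1)%N -> is_form d g ->
  exists c : {set 'I_R} -> F, forall x,
    g x = \sum_(V : {set 'I_R} | (V \subset U) && (#|V| == d)) c V * hprod V x.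
Proof.
pose P d (U : {set 'I_R}) g := exists c : {set 'I_R} -> F, forall x,
  g x = \sum_(V : {set 'I_R} | (V \subset U) && (#|V| == d)) c V * hprod V x.
have Psum (d' : nat) U' (T : finType) (Q : pred T) (gs : T -> 'rV_k -> F) :
    (forall i, Q i -> P d' U' (gs i)) -> P d' U' (fun x => \sum_(i | Q i) gs i x).
  move=> gsP; have /fin_all_exists[c cE] : forall i, exists c, Q i -> forall x,
      gs i x = \sum_(V : {set 'I_R} | (V \subset U') && (#|V| == d')) c V * hprod V x.
    move=> i; case Qi : (Q i); last by exists (fun=> 0).
    by have [a ga] := gsP i Qi; exists a.
  exists (fun V => \sum_(i | Q i) c i V) => x; under eq_bigr => i Qi do rewrite cE //.
  by rewrite exchange_big; apply: eq_bigr => V _; rewrite mulr_suml.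
have Pscale (d' : nat) U' b (g' : 'rV_k -> F) : P d' U' g' -> P d' U' (fun x => b * g' x).
  move=> [c cE]; exists (fun V => b * c V) => x.
  by rewrite cE mulr_sumr; apply: eq_bigr => V _; rewrite mulrA.
have Pext (d' : nat) U' (g' g'' : 'rV_k -> F) : g' =1 g'' -> P d' U' g' -> P d' U' g''.
  by move=> E [c cE]; exists c => x; rewrite -E.
have Ph (U' V' : {set 'I_R}) : V' \subset U' -> P #|V'| U' (hprod V').
  move=> VU; exists (fun V => (V == V')%:R) => x.
  rewrite (bigD1 V') /=; last by rewrite VU eqxx.
  by rewrite eqxx mul1r big1 ?addr0 // => V /andP[_ /negPf ->]; rewrite mul0r.
move=> kd [a gE]; apply: (Pext _ _ (fun x => \sum_f a f * mono f x)) => //.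
apply: (Psum) => f _; apply: (Pscale); move: kd f {a gE}.
elim: d U => [|d IH] U kd f.
  apply: (Pext _ _ (hprod set0)) => [x|]; first by rewrite /hprod /mono big_set0 big_ord0.
  by have := Ph U set0 (sub0set _); rewrite cards0.
have /card_gt0P[u uU] : (0 < #|U|)%N by lia.
have := IH (U :\ u) _ [ffun i => f (lift ord0 i)]; case; first by rewrite (cardsD1 u) uU in kd; lia.
move=> c cE.
apply: (Pext _ _ (fun x => \sum_(V : {set 'I_R} | (V \subset U :\ u) && (#|V| == d))
    c V * (linf (delta_mx (f ord0) 0) x * hprod V x))) => [x|].
  rewrite /mono big_ord_recl /linf -colE mxE.
  under eq_bigr => V _ do rewrite mulrCA.
  rewrite -mulr_sumr -cE; congr (_ * _).
  by apply: eq_bigr => i _; rewrite ffunE.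
apply: (Psum) => V /andP[VU /eqP Vd]; apply: (Pscale).
have [|b bE] := gp_span gpC (S := U :\: V) (delta_mx (f ord0) (0 : 'I_1)).
  rewrite cardsD (setIidPr _) ?Vd; first by lia.
  by rewrite (subset_trans VU) ?subsetDl.
apply: (Pext _ _ (fun x => \sum_(r in U :\: V) b r * hprod (r |: V) x)) => [x|].
  rewrite bE /linf mulmx_sumr summxE mulr_suml; apply: eq_bigr => r.
  rewrite inE => /andP[rV _]; rewrite -scalemxAr mxE -mulrA; congr (_ * _).
  by rewrite /hprod big_setU1 //= mul_col.
apply: (Psum) => r; rewrite inE => /andP[rV rU]; apply: (Pscale).
have -> : d.+1 = #|r |: V| by rewrite cardsU1 rV Vd.
by apply: (Ph); rewrite subUset sub1set rU (subset_trans VU) ?subsetDl.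
Qed.

Variable pt : {set 'I_R} -> 'rV[F]_k.
Hypothesis ptP :
  forall V : {set 'I_R}, #|V| = n.+1 -> forall r, ((pt V *m C) 0 r == 0) = (r \notin V).

Lemma hprod_pt (V V' : {set 'I_R}) : #|V| = n.+1 -> #|V'| = n.+1 ->
  (hprod V (pt V') == 0) = (V' != V).
Proof.
move=> Vn V'n; apply/idP/idP => [|VV'].
  apply: contraTneq => ->; apply/prodf_neq0 => r rV; by rewrite ptP // rV.
have /subsetPn[r rV rV'] : ~~ (V \subset V').
  by apply: contra VV' => VV'; rewrite eq_sym eqEcard VV' V'n Vn leqnn.
by apply/prodf_eq0; exists r => //; rewrite ptP.
Qed.

(** [form_span] with all columns writes [g] in terms of the [hprod V]; all but one of these vanish
    at [pt V], where evaluation isolates one coefficient. *)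
Lemma interpolation g : is_form n.+1 g -> forall x,
  g x = \sum_(V : {set 'I_R} | #|V| == n.+1) g (pt V) / hprod V (pt V) * hprod V x.
Proof.
move=> gf; have [|c cE] := @form_span n.+1 setT g _ gf.
  by rewrite cardsT card_ord; lia.
move=> x; rewrite cE; apply: eq_big => [V|V /andP[_ /eqP Vn]]; first by rewrite subsetT.
congr (_ * _); rewrite cE (bigD1 V) /=; last by rewrite subsetT Vn eqxx.
rewrite big1 ?addr0 ?mulfK // ?hprod_pt ?negbK //.
move=> W /andP[/andP[_ /eqP Wn] WV]; apply/eqP.
by rewrite mulf_eq0 hprod_pt // (eq_sym V) WV orbT.
Qed.

(* For each [V], the vector [\sum_p l p * hprod C V (q p) *: q p] is orthogonal to
   the columns of [C] outside [V], so it is a multiple of [pt V]. *)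
Lemma functional_decomposition (P : finType) (l : P -> F) (q : P -> 'rV[F]_k) :
  (forall U : {set 'I_R}, #|U| = n.+2 -> \sum_p l p * hprod U (q p) = 0) ->
  exists mu : {set 'I_R} -> F, forall c g, is_form n.+1 g ->
    \sum_p l p * (linf c (q p) * g (q p)) =
    \sum_(V : {set 'I_R} | #|V| == n.+1) mu V * (linf c (pt V) * g (pt V)).
Proof.
move=> l0; pose v V := \sum_p (l p * hprod V (q p)) *: q p.
have /fin_all_exists[a aE] : forall V : {set 'I_R}, exists a, #|V| = n.+1 -> v V = a *: pt V.
  move=> V; have [Vn|Vn] := eqVneq #|V| n.+1; last by exists 0 => /eqP; rewrite (negPf Vn).
  have [|b bE] := gp_point_uniq gpC Rkn Vn (ptP Vn) (y := v V); last by exists b.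
  move=> r; rewrite inE => rV; rewrite -[RHS](l0 (r |: V)); last by rewrite cardsU1 rV Vn.
  rewrite /v mulmx_suml summxE; apply: eq_bigr => p _.
  by rewrite -scalemxAl mxE -mulrA /hprod big_setU1 //= [_ * \prod_(_ in V) _]mulrC.
exists (fun V => a V / hprod V (pt V)) => c g gf.
(* Interpolating [g] at each [q p] leaves, for each [V], the value of the linear form [c] at
   [v V]. *)
under eq_bigr => p _ do rewrite (interpolation gf (q p)) !mulr_sumr.
rewrite exchange_big; apply: eq_bigr => V /eqP Vn /=.
transitivity (g (pt V) / hprod V (pt V) * linf c (v V)).
  rewrite /linf /v mulmx_suml summxE mulr_sumr; apply: eq_bigr => p _.
  by rewrite -scalemxAl [in RHS]mxE; ring.
by rewrite aE // /linf -scalemxAl [in LHS]mxE; ring.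
Qed.

End Interpolation.

(** * Uniqueness *)

Lemma core_tr (F : fieldType) I J R (A : 'M[F]_(I, R)) (B : 'M[F]_(J, R)) w :
  (core A B w)^T = core B A w.
Proof. by rewrite /core !trmx_mul trmxK tr_diag_mx mulmxA. Qed.

Lemma core_mul_supp (F : fieldType) I J R (A : 'M[F]_(I, R)) (B : 'M[F]_(J, R))
    (w : 'rV[F]_R) (y : 'cV[F]_J) :
  exists2 z : 'cV[F]_R, (forall r, w 0 r = 0 -> z r 0 = 0) & core A B w *m y = A *m z.
Proof.
exists (diag_mx w *m (B^T *m y)); last by rewrite /core !mulmxA.
by move=> r wr; rewrite mul_diag_mx mxE wr mul0r.
Qed.

(** The core is the product of the columns of [A] in the support with a matrix [N]. The rank
    hypothesis makes [N] row free, and a right inverse of [N] returns these columns. *)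
Lemma col_in_core (F : fieldType) I J R (A : 'M[F]_(I, R)) (B : 'M[F]_(J, R))
    (w : 'rV[F]_R) r :
  (#|[set r | (w 0 r != 0)%R]| <= \rank (core A B w))%N -> w 0 r != 0 ->
  exists y : 'cV[F]_J, col r A = core A B w *m y.
Proof.
set U := [set r | _]; pose f (i : 'I_#|U|) := enum_val i => rU wr.
pose N := rowsub f (diag_mx w *m B^T).
have coreN : core A B w = colsub f A *m N := core_supp A B w.
have /row_freeP[Y NY] : row_free N.
  by rewrite /row_free eqn_leq rank_leq_row (leq_trans rU) // coreN mxrankM_maxr.
have rU' : r \in U by rewrite inE.
exists (col (enum_rank_in rU' r) Y).
have E : core A B w *m Y = colsub f A by rewrite coreN -mulmxA NY mulmx1.
rewrite [col _ Y]colE mulmxA E -colE; apply/colP => i.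
by rewrite !mxE /f enum_rankK_in.
Qed.

(* Two of the sets [V] suffice to kill one coefficient of [v], since their union
   has [n.+2] elements. *)
Lemma common_column (F : fieldType) I R n (A : 'M[F]_(I, R)) q (v : 'cV[F]_I) :
  (n.+1 < R)%N -> (n.+1 < krank A)%N ->
  (forall V : {set 'I_R}, #|V| = n.+1 -> q \in V ->
    exists2 z : 'cV[F]_R, (forall r, r \notin V -> z r 0 = 0) & v = A *m z) ->
  exists a, v = a *: col q A.
Proof.
move=> nR nA vV.
have [||V [qV _ Vn]] := @subset_between _ [set q] setT n.+1.
- exact: subsetT.
- by rewrite cards1 cardsT card_ord /= ltnW.
have [z zV vz] := vV V Vn (subsetP qV q (set11 q)).
exists (z q 0); rewrite vz; suff -> : z = z q 0 *: delta_mx q 0.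
  by rewrite -scalemxAr -colE !mxE eqxx mulr1.
apply/colP => s; rewrite !mxE; have [->|sq] := eqVneq s q; first by rewrite mulr1.
rewrite mulr0; have [sV|/zV //] := boolP (s \in V).
(* Exchanging [s] for some [u] outside [V] gives a second set containing [q]. Both expressions of
   [v] agree on the free columns [u |: V], so the coefficient at [s] is 0. *)
have /subsetPn[u _ uV] : ~~ (setT \subset V).
  by apply/negP => /subset_leq_card; rewrite cardsT card_ord Vn leqNgt nR.
have us : u != s by apply: contraNneq uV => ->.
have [||z' zV' vz'] := vV (u |: V :\ s).
- by rewrite cardsU1 !inE (negPf uV) andbF; move: (cardsD1 s V); rewrite sV Vn => ->.
- by rewrite !inE (eq_sym q s) sq (subsetP qV _ (set11 q)) orbT.
have /columns_freeP free : columns_free A (u |: V).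
  by apply: krank_columns_free; rewrite cardsU1 uV Vn.
have /free : forall r, r \notin u |: V -> (z - z') r 0 = 0.
  move=> r; rewrite !inE negb_or => /andP[ru rV].
  by rewrite !mxE zV // zV' ?subrr // !inE negb_or ru (negPf rV) andbF.
rewrite mulmxBr -vz -vz' subrr => /(_ erefl)/matrixP/(_ s 0).
by rewrite !mxE (zV' s) ?subr0 // !inE negb_or eq_sym us eqxx.
Qed.

Section ProjectedUniqueness.
Variables (F : numFieldType) (I J k R n : nat).
Variables (A : 'M[F]_(I, R)) (B : 'M[F]_(J, R)) (C : 'M[F]_(k, R)).
Hypotheses (gpC : general_position C) (Rkn : R = (k + n)%N) (k1 : (1 < k)%N).
Hypotheses (kB : (n.+1 < krank B)%N) (kAB : (R + n.+1 < krank A + \rank B)%N).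

Lemma card_supp_gt (x : 'rV[F]_k) :
  x != 0 -> (n < #|[set r | ((x *m C) 0 r != 0)%R]|)%N.
Proof. by apply: (gp_supp gpC); rewrite Rkn. Qed.

(** The support is cut down to at most [n.+2] elements, where [rank_core] applies by [kB] and
    [kAB]. *)
Lemma rank_core_min (w : 'rV[F]_R) :
  (minn n.+2 #|[set r | (w 0 r != 0)%R]| <= \rank (core A B w))%N.
Proof.
set U := [set r | _].
have [|S [_ SU SU']] := @subset_between _ set0 U (minn n.+2 #|U|) (sub0set _).
  by rewrite cards0 geq_minr.
rewrite -SU'; apply: rank_core; rewrite ?SU'; [move: kB; clear; lia|move: kAB; clear; lia|].
by move=> r /(subsetP SU); rewrite inE.
Qed.

Section Other.
Variables (R' : nat) (A' : 'M[F]_(I, R')) (B' : 'M[F]_(J, R')) (C' : 'M[F]_(k, R')).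
Hypothesis coreE' : forall x : 'rV[F]_k, core A B (x *m C) = core A' B' (x *m C').

(** The common matrix has rank at least [n.+1] by the first decomposition, and at most the support
    size in the second. *)
Lemma other_supp (x : 'rV[F]_k) : x != 0 ->
  (n < #|[set r | ((x *m C') 0 r != 0)%R]|)%N.
Proof.
move=> /card_supp_gt nx; apply: leq_trans (rank_core_leq A' B' _).
rewrite -coreE'; apply: leq_trans (rank_core_min _).
by rewrite leq_min nx leqnSn.
Qed.

(** If [R' < R], some nonzero [x] vanishes at [k.-1] columns of [C'], or at all of them, and its
    support has at most [n] elements. *)
Lemma other_terms : (R <= R')%N.
Proof.
rewrite leqNgt; apply/negP => R'R.
have [|S [_ _ Sk]] := @subset_between _ set0 [set: 'I_R'] (minn k.-1 R') (sub0set _).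
  by rewrite cards0 cardsT card_ord geq_minr.
have [|x x0 xS] := @zero_point _ _ _ C' S; first by rewrite Sk; lia.
have := other_supp x0; apply/negP; rewrite -leqNgt.
apply: leq_trans (_ : #|~: S| <= _)%N; last by have := cardsC S; rewrite card_ord; lia.
by apply/subset_leq_card/subsetP => r; rewrite !inE; apply: contra => /xS ->.
Qed.

Lemma other_general_position : (R' <= R)%N -> general_position C'.
Proof.
move=> R'R; apply: (@supp_general_position _ _ _ _ n) => [|x]; first lia.
exact: other_supp.
Qed.

End Other.

Section Same.
Variables (A' : 'M[F]_(I, R)) (B' : 'M[F]_(J, R)) (C' : 'M[F]_(k, R)).
Hypothesis coreE' : forall x : 'rV[F]_k, core A B (x *m C) = core A' B' (x *m C').

Let gpC' : general_position C' := other_general_position coreE' (leqnn R).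
Let k0 : (0 < k)%N := ltnW k1.

(* [x |-> core A' B' (x *m C')] has rank at most [n.+1] at each [pt' V'], which is
   thus a multiple of some [pt V]. By counting, every [pt V] arises in this way, so
   [hprod C' V'] vanishes at all but one of them and interpolation applies. *)
Lemma hprod_match r : exists (V V' : {set 'I_R}) (b : F),
  [/\ r \in V', b != 0 & forall x, hprod C' V' x = b * hprod C V x].
Proof.
have [pt ptP] := gp_points gpC Rkn k0; have [pt' ptP'] := gp_points gpC' Rkn k0.
pose pi V' := [set r | ((pt' V' *m C) 0 r != 0)%R].
have pt0 (V' : {set 'I_R}) : #|V'| = n.+1 -> pt' V' != 0.
  move=> Vn'; have /card_gt0P[s sV] : (0 < #|V'|)%N by rewrite Vn'.
  by apply: contraTneq sV => p0; rewrite -ptP' // p0 mul0mx mxE.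
have suppV' (V' : {set 'I_R}) : #|V'| = n.+1 ->
    [set r | ((pt' V' *m C') 0 r != 0)%R] = V'.
  by move=> Vn'; apply/setP => s; rewrite inE ptP' ?negbK.
(* The rank at [pt' V'] is at most [n.+1], so the minimum in [rank_core_min] is the support size. *)
have pin (V' : {set 'I_R}) : #|V'| = n.+1 -> #|pi V'| = n.+1.
  move=> Vn'; have := card_supp_gt (pt0 _ Vn'); have := rank_core_min (pt' V' *m C).
  rewrite -/(pi V') coreE' => /leq_trans/(_ (rank_core_leq A' B' _)).
  by rewrite suppV' // Vn'; lia.
have ptE (V' : {set 'I_R}) : #|V'| = n.+1 -> exists2 a, a != 0 & pt' V' = a *: pt (pi V').
  move=> Vn'; have [|a aE] := gp_point_uniq gpC Rkn (pin _ Vn') (ptP _ (pin _ Vn')) (y := pt' V').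
    by move=> s; rewrite !inE negbK => /eqP.
  by exists a => //; apply: contraNneq (pt0 _ Vn') => a0; rewrite aE a0 scale0r.
pose VV := [set V : {set 'I_R} | #|V| == n.+1].
have pi_inj : {in VV &, injective pi}.
  move=> V1 V2; rewrite !inE => /eqP V1n /eqP V2n pi12.
  have [a1 a10 E1] := ptE _ V1n; have [a2 a20 E2] := ptE _ V2n.
  apply/setP => s; apply: negb_inj; rewrite -!ptP' // E1 E2 pi12.
  by rewrite -!scalemxAl [in LHS]mxE [in RHS]mxE !mulf_eq0 (negPf a10) (negPf a20).
have piVV : pi @: VV = VV.
  apply/eqP; rewrite eqEcard card_in_imset // leqnn andbT.
  apply/subsetP => W /imsetP[V]; rewrite !inE => /eqP Vn ->; by rewrite pin.
have [|V' [rV _ Vn']] := @subset_between _ [set r] setT n.+1 (subsetT _).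
  by rewrite cards1 cardsT card_ord /=; lia.
(* The coefficient of the only term that survives in the interpolation formula. *)
exists (pi V'), V', (hprod C' V' (pt (pi V')) / hprod C (pi V') (pt (pi V'))).
split=> [||x]; first exact: subsetP rV _ (set11 r).
  rewrite mulf_neq0 ?invr_eq0 //; last by rewrite (hprod_pt ptP) ?negbK ?pin.
  have [a a0 pE] := ptE _ Vn'; apply/prodf_neq0 => s sV.
  have : (pt' V' *m C') 0 s != 0 by rewrite ptP' // sV.
  by rewrite pE -scalemxAl mxE mulf_eq0 negb_or => /andP[].
have fV' : is_form n.+1 (hprod C' V') by rewrite -Vn'; apply: form_hprod.
rewrite (interpolation gpC Rkn k0 ptP fV') (bigD1 (pi V')) /= ?pin //.
rewrite big1 ?addr0 // => V /andP[/eqP Vn VV'].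
have /imsetP[V2] : V \in pi @: VV by rewrite piVV inE Vn.
rewrite inE => /eqP V2n VE; have [a a0 pE] := ptE _ V2n.
have V2V' : V2 != V' by apply: contraNneq VV' => <-; rewrite VE.
have : hprod C' V' (pt' V2) == 0 by rewrite (hprod_pt ptP').
case/prodf_eq0 => s sV; rewrite pE -scalemxAl mxE mulf_eq0 (negPf a0) /= -VE => /eqP ps.
suff -> : hprod C' V' (pt V) = 0 by rewrite !mul0r.
by apply/eqP/prodf_eq0; exists s => //; rewrite ps.
Qed.

Lemma gp_col_neq0 (C1 : 'M[F]_(k, R)) r : general_position C1 -> col r C1 != 0.
Proof.
move=> gp1; have [|||x _] := @gp_separate _ _ _ C1 gp1 set0 r; rewrite ?cards0 ?inE //; first lia.
by apply: contraNneq => c0; rewrite mul_col c0 /linf mulmx0 mxE.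
Qed.

(* The product of the linear forms [hprod C V] vanishes on the hyperplane
   orthogonal to [col r C'], hence so does one of its factors. *)
Lemma col_match r : exists s, exists2 d, d != 0 & col r C' = d *: col s C.
Proof.
have [V [V' [b [rV' b0 hE]]]] := hprod_match r.
have [s /eqP sP] : exists s, kermx (col r C') *m col s C == 0.
  apply/existsP; apply: contraT; rewrite negb_exists => /forallP H.
  (* Otherwise some combination of the rows of the kernel is orthogonal to no column of [C],
     although [hprod C V] vanishes on the whole hyperplane. *)
  have [|t tP] := @moment_avoid F _ xpredT _ (fun s => kermx (col r C') *m col s C).
    by move=> s _; apply: H.
  pose x := moment F k t *m kermx (col r C').
  have : hprod C' V' x == 0.
    apply/prodf_eq0; exists r => //.
    by rewrite mul_col /linf /x -mulmxA mulmx_ker mulmx0 mxE.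
  rewrite hE mulf_eq0 (negPf b0) => /prodf_eq0[s _].
  by rewrite mul_col /linf /x -mulmxA (negPf (tP s isT)).
have /matrix0Pn[i [j ci]] := gp_col_neq0 r gpC'; rewrite ord1 {j} in ci.
(* The vector [x] below is orthogonal to [col r C'], hence to [col s C], which fixes the ratios of
   entries. *)
have ds (l : 'I_k) : col s C l 0 = col r C' l 0 / col r C' i 0 * col s C i 0.
  pose x : 'rV[F]_k := delta_mx 0 l - (col r C' l 0 / col r C' i 0) *: delta_mx 0 i.
  have dE (c : 'cV[F]_k) : x *m c =
      (c l 0 - col r C' l 0 / col r C' i 0 * c i 0)%:M.
    apply/matrixP => a b'; rewrite !ord1 mulmxBl -scalemxAl -!rowE.
    by rewrite !mxE mulr1n.
  have /sub_kermxP/submxP[y xy] : x *m col r C' = 0.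
    by rewrite dE divfK // subrr raddf0.
  have : x *m col s C = 0 by rewrite xy -mulmxA sP mulmx0.
  rewrite dE => /matrixP/(_ 0 0); rewrite [LHS]mxE mulr1n [RHS]mxE.
  by move/eqP; rewrite subr_eq0 => /eqP.
have csE : col s C = (col s C i 0 / col r C' i 0) *: col r C'.
  by apply/colP => l; rewrite ds [RHS]mxE; ring.
move: (col s C i 0 / _) csE => d csE.
have d0 : d != 0.
  by apply: contraNneq (gp_col_neq0 s gpC) => d0; rewrite csE d0 scale0r.
by exists s, d^-1; rewrite ?invr_eq0 // csE scalerA mulVf ?scale1r.
Qed.

(** Two columns of [C'] matched with the same column of [C] would be proportional, which general
    position excludes as [k > 1]. *)
Lemma perm_match : exists (s : 'S_R) (d : 'I_R -> F),
  forall r, d r != 0 /\ col r C' = d r *: col (s r) C.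
Proof.
have /fin_all_exists[s sP] : forall r, exists s, exists d, d != 0 /\ col r C' = d *: col s C.
  by move=> r; have [s [d d0 E]] := col_match r; exists s, d.
have /fin_all_exists[d dP] := sP.
have s_inj : injective s.
  move=> r1 r2 s12; apply: contraTeq isT => r12.
  have [|||x x1 /negP[]] := @gp_separate _ _ _ C' gpC' [set r1] r2.
  - by lia.
  - by rewrite cards1.
  - by rewrite inE eq_sym.
  have := x1 r1 (set11 r1); have [d1 E1] := dP r1; have [d2 E2] := dP r2.
  rewrite !mul_col E1 E2 s12 /linf -!scalemxAr [LHS]mxE => /eqP.
  by rewrite mulf_eq0 (negPf d1) /= => /eqP E; rewrite mxE E mulr0.
by exists (perm s_inj), d => r; rewrite permE.
Qed.

End Same.

End ProjectedUniqueness.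

(** For each [V] containing [s r], column [r] of [A'] lies in the column space of the matrix at
    [pt V], hence in the span of the columns of [A] in [V]; [common_column] intersects these spans.
    Transposed cores give the same for [B]. *)
Lemma col_match_left (F : fieldType) (I J k R n : nat)
    (A A' : 'M[F]_(I, R)) (B B' : 'M[F]_(J, R)) (C C' : 'M[F]_(k, R))
    (pt : {set 'I_R} -> 'rV[F]_k) (s : 'S_R) (d : 'I_R -> F) :
  (n.+1 < R)%N -> (n.+1 < krank A)%N ->
  (forall V : {set 'I_R}, #|V| = n.+1 -> forall r, ((pt V *m C) 0 r == 0) = (r \notin V)) ->
  (forall V : {set 'I_R}, #|V| = n.+1 -> (n < \rank (core A B (pt V *m C)))%N) ->
  (forall x : 'rV[F]_k, core A B (x *m C) = core A' B' (x *m C')) ->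
  (forall r, d r != 0 /\ col r C' = d r *: col (s r) C) ->
  forall r, exists a, col r A' = a *: col (s r) A.
Proof.
move=> nR kA ptP rkP coreE' dP r; apply: (common_column nR kA) => V Vn sV.
have wE r' : ((pt V *m C') 0 r' == 0) = (s r' \notin V).
  have [d0 E] := dP r'; rewrite -ptP // mul_col E /linf -scalemxAr mxE.
  by rewrite mulf_eq0 (negPf d0) /= (mul_col C) /linf.
have [||y yE] := @col_in_core _ _ _ _ A' B' (pt V *m C') r.
- rewrite -coreE'; apply: leq_trans (rkP V Vn); rewrite -Vn -(card_preimset V (@perm_inj _ s)).
  by apply/subset_leq_card/subsetP => r'; rewrite !inE wE negbK.
- by rewrite wE negbK.
have [z zV zE] := core_mul_supp A B (pt V *m C) y.
exists z; last by rewrite yE -coreE'.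
by move=> r' r'V; apply: zV; apply/eqP; rewrite ptP.
Qed.

(** * Rank and uniqueness for the original tensor *)

Section Contraction.
Variables (F : realType) (I J K : nat).

Definition contract (T : tensor F I J K) (y : 'rV[F]_K) : 'M[F]_(I, J) :=
  \sum_l y 0 l *: slice T l.

Lemma polyadicE R (A : 'M[F]_(I, R)) (B : 'M[F]_(J, R)) (C : 'M[F]_(K, R)) i j l :
  polyadic A B C (i, j, l) = \sum_r A i r * B j r * C l r.
Proof.
by rewrite /polyadic sum_ffunE; apply: eq_bigr => r _; rewrite !ffunE !mxE.
Qed.

Lemma contract_polyadic R (A : 'M[F]_(I, R)) (B : 'M[F]_(J, R)) (C : 'M[F]_(K, R)) y :
  contract (polyadic A B C) y = core A B (y *m C).
Proof.
apply/matrixP => i j; rewrite coreE summxE.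
under eq_bigr => l _ do rewrite !mxE polyadicE mulr_sumr.
rewrite exchange_big; apply: eq_bigr => r _ /=.
rewrite mxE mulr_sumr mulr_suml; apply: eq_bigr => l _; ring.
Qed.

Lemma polyadic_projected R R' (A : 'M[F]_(I, R)) (B : 'M[F]_(J, R)) (C : 'M[F]_(K, R))
    (A' : 'M[F]_(I, R')) (B' : 'M[F]_(J, R')) (C' : 'M[F]_(K, R')) k (Phi : 'M[F]_(k, K)) :
  polyadic A B C = polyadic A' B' C' ->
  forall x : 'rV[F]_k, core A B (x *m (Phi *m C)) = core A' B' (x *m (Phi *m C')).
Proof. by move=> E x; rewrite !mulmxA -!contract_polyadic E. Qed.

(** Vanishing terms are discarded; if none is lost, all terms have rank 1. *)
Lemma sum_of_rank1_leq R (A : 'M[F]_(I, R)) (B : 'M[F]_(J, R)) (C : 'M[F]_(K, R)) :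
  exists2 m, sum_of_rank1 (polyadic A B C) m &
    (m <= R)%N /\ (m = R -> forall r, rank1_tensor (outer (col r A) (col r B) (col r C))).
Proof.
pose t r := outer (col r A) (col r B) (col r C).
pose U := [set r | t r != 0].
have tP r : t r != 0 -> rank1_tensor (t r).
  move=> tr; exists (col r A), (col r B), (col r C); split=> //.
  - by apply: contraNneq tr => c0; apply/eqP/ffunP => x; rewrite !ffunE c0 !mxE !mul0r.
  - by apply: contraNneq tr => c0; apply/eqP/ffunP => x; rewrite !ffunE c0 !mxE mulr0 mul0r.
  - by apply: contraNneq tr => c0; apply/eqP/ffunP => x; rewrite !ffunE c0 !mxE mulr0.
exists #|U|.
  exists (fun i => t (enum_val i)) => [i|].
    by apply: tP; have := enum_valP i; rewrite inE.
  rewrite -(big_enum_val t) [LHS](bigID (mem U)) /= [X in _ + X]big1 ?addr0 //.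
  by move=> r; rewrite inE negbK => /eqP.
split=> [|UR r]; first by rewrite -[leqRHS]card_ord max_card.
apply: tP; have /eqP UT : U == setT by rewrite eqEcard subsetT UR cardsT card_ord leqnn.
by have := in_setT r; rewrite -UT inE.
Qed.

Lemma sum_of_rank1_polyadic (T : tensor F I J K) m : sum_of_rank1 T m ->
  exists (A : 'M[F]_(I, m)) (B : 'M[F]_(J, m)) (C : 'M[F]_(K, m)), T = polyadic A B C.
Proof.
case=> t tP ->.
have /fin_all_exists[a aP] : forall r, exists a, exists b, exists c, t r = outer a b c.
  by move=> r; have [a [b [c [_ _ _ ->]]]] := tP r; exists a, b, c.
have /fin_all_exists[b bP] := aP; have /fin_all_exists[c cP] := bP.
exists (\matrix_(i, r) a r i 0), (\matrix_(i, r) b r i 0), (\matrix_(i, r) c r i 0).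
apply: eq_bigr => r _; rewrite cP; congr (outer _ _ _);
  by apply/colP => i; rewrite !mxE.
Qed.

End Contraction.

Section Uniqueness.
Variables (F : realType) (I J K R : nat).
Variables (A : 'M[F]_(I, R)) (B : 'M[F]_(J, R)) (C : 'M[F]_(K, R)).
Hypothesis kABC : (2 * R + 2 <= krank A + \rank B + krank C)%N.
Hypothesis kBC : (R + 2 <= krank B + krank C)%N.

Definition excess := (R - krank C)%N.

(** All bounds follow from the two hypotheses because the k-ranks and [\rank B] are at most [R]. *)
Lemma krank_bounds : [/\ R = (krank C + excess)%N, (1 < krank C)%N,
  (excess.+1 < krank B)%N, (R + excess.+1 < krank A + \rank B)%N
  & (excess.+1 < krank A)%N /\ (excess.+1 < R)%N].
Proof.
have := krank_leq A; have := krank_leq B; have := krank_leq C; have := rank_leq_col B.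
by rewrite /excess; split; try split; lia.
Qed.

Lemma terms_min R' (A' : 'M[F]_(I, R')) (B' : 'M[F]_(J, R')) (C' : 'M[F]_(K, R')) :
  polyadic A B C = polyadic A' B' C' -> (R <= R')%N.
Proof.
have [Rkn k1 kB kAB _] := krank_bounds => E.
have [t gp] := gp_projection (leqnn (krank C)).
exact: other_terms gp Rkn k1 kB kAB _ _ _ _ (polyadic_projected _ E).
Qed.

Lemma tensor_rank : has_tensor_rank (polyadic A B C) R.
Proof.
have min m : sum_of_rank1 (polyadic A B C) m -> (R <= m)%N.
  by move=> /sum_of_rank1_polyadic[A' [B' [C']]] /terms_min.
split=> //; have [m Tm [mR _]] := sum_of_rank1_leq A B C.
have /eqP mE : m == R by rewrite eqn_leq mR min.
by rewrite mE in Tm.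
Qed.

Lemma exact_terms (A' : 'M[F]_(I, R)) (B' : 'M[F]_(J, R)) (C' : 'M[F]_(K, R)) :
  polyadic A B C = polyadic A' B' C' -> is_cpd (polyadic A B C) A' B' C'.
Proof.
move=> E; split=> //; first exact: tensor_rank.
have [m Tm [mR]] := sum_of_rank1_leq A' B' C'; apply.
by apply/eqP; rewrite eqn_leq mR; move: Tm; rewrite -E => /tensor_rank.2.
Qed.

(** The projected matrices give the permutation and the columns of [A'] and [B'] up to scalars. The
    full columns of [C] are then read off from the original slices. *)
Lemma same_factors (A' : 'M[F]_(I, R)) (B' : 'M[F]_(J, R)) (C' : 'M[F]_(K, R)) :
  polyadic A B C = polyadic A' B' C' -> same_cpd A B C A' B' C'.
Proof.
have [Rkn k1 kB kAB [kA nR]] := krank_bounds => E.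
have [t gp] := gp_projection (leqnn (krank C)).
set Phi := vandermonde _ _ _ in gp.
have coreP := polyadic_projected Phi E.
have [s [d dP]] := perm_match gp Rkn k1 kB kAB coreP.
have [pt ptP] := gp_points gp Rkn (ltnW k1).
have rkP (V : {set 'I_R}) : #|V| = excess.+1 ->
    (excess < \rank (core A B (pt V *m (Phi *m C))))%N.
  move=> Vn; apply: leq_trans (rank_core_min kB kAB _).
  suff -> : [set r | ((pt V *m (Phi *m C)) 0 r != 0)%R] = V by rewrite Vn; lia.
  by apply/setP => r; rewrite inE ptP // negbK.
have /fin_all_exists[a aP] := col_match_left nR kA ptP rkP coreP dP.
have coreP' x : core B A (x *m (Phi *m C)) = core B' A' (x *m (Phi *m C')).
  by rewrite -!(core_tr A) -(core_tr A') coreP.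
have rkP' (V : {set 'I_R}) : #|V| = excess.+1 ->
    (excess < \rank (core B A (pt V *m (Phi *m C))))%N.
  by move=> /rkP; rewrite -core_tr mxrank_tr.
have /fin_all_exists[b bP] := col_match_left nR kB ptP rkP' coreP' dP.
have cP r : col (s r) C = (a r * b r) *: col r C'.
  have [||x [y xy]] := @dual_families _ _ _ _ A B [set s r].
  - by rewrite cards1; lia.
  - by rewrite cards1; lia.
  have q1 := set11 (s r); apply/colP => l; rewrite !mxE.
  (* Vectors dual to [s r] extract [C l (s r)] from slice [l]; the other decomposition gives
     [a r * b r * C' l r] for the same value. *)
  have := bilinear_core_dual (row l C) xy q1 q1; rewrite eqxx mulr1n [RHS]mxE => <-.
  have -> : core A B (row l C) = core A' B' (row l C').
    by rewrite !rowE -!contract_polyadic E.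
  rewrite bilinear_core (bigD1 r) //= big1 ?addr0.
    rewrite (mul_col A') (mul_col B') aP bP /linf -!scalemxAr.
    rewrite [X in X * _ * _]mxE [X in _ * X]mxE.
    have := xy (s r) (s r) q1 q1 (s r); rewrite eqxx andbT mulr1n.
    rewrite (mul_col A) (mul_col B) /linf => xy1.
    rewrite -[RHS]mulr1 -xy1 [row l C' _ _]mxE; ring.
  move=> r' r'r; rewrite (mul_col A') (mul_col B') aP bP /linf -!scalemxAr.
    rewrite [X in X * _ * _]mxE [X in _ * X]mxE.
  have := xy (s r) (s r) q1 q1 (s r'); rewrite (inj_eq perm_inj) (negPf r'r) /=.
  rewrite (mul_col A) (mul_col B) /linf => xy0.
  by rewrite mulrAC mulrACA xy0 mulr0 mul0r.
have ab0 r : a r * b r != 0.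
  have := krank_col_neq0 (s r) (ltnW k1).
  by apply: contraNneq => ab0; rewrite cP ab0 scale0r.
exists s, a, b, (fun r => (a r * b r)^-1) => r; split=> //; first by rewrite mulfV.
by rewrite cP scalerA mulVf ?scale1r.
Qed.

End Uniqueness.

Lemma same_cpd_trans (F : realType) I J K R
    (A A1 A2 : 'M[F]_(I, R)) (B B1 B2 : 'M[F]_(J, R)) (C C1 C2 : 'M[F]_(K, R)) :
  same_cpd A B C A1 B1 C1 -> same_cpd A B C A2 B2 C2 -> same_cpd A1 B1 C1 A2 B2 C2.
Proof.
move=> [s1 [a1 [b1 [c1 H1]]]] [s2 [a2 [b2 [c2 H2]]]].
pose u r := (s1^-1)%g (s2 r).
exists (s2 * s1^-1)%g, (fun r => a2 r / a1 (u r)), (fun r => b2 r / b1 (u r)),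
  (fun r => c2 r / c1 (u r)) => r.
have -> : (s2 * s1^-1)%g r = u r by rewrite permM.
have [E2 A2E B2E C2E] := H2 r; have [E1 A1E B1E C1E] := H1 (u r).
have /andP[/andP[a0 b0] c0] : (a1 (u r) != 0) && (b1 (u r) != 0) && (c1 (u r) != 0).
  by rewrite -!negb_or -!mulf_eq0 E1 oner_neq0.
rewrite A1E B1E C1E A2E B2E C2E /u permKV !scalerA !divfK //; split=> //.
rewrite -[RHS]divr1 -{2}E1 -E2; field.
by rewrite a0 b0 c0.
Qed.

Lemma unique_cpd (F : realType) I J K R
    (A : 'M[F]_(I, R)) (B : 'M[F]_(J, R)) (C : 'M[F]_(K, R)) :
  (2 * R + 2 <= krank A + \rank B + krank C)%N ->
  (R + 2 <= krank B + krank C)%N -> cpd_unique (polyadic A B C).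
Proof.
move=> kABC kBC R1 A1 B1 C1 A2 B2 C2 [rk1 _ E1] [_ _ E2].
have rk := tensor_rank kABC kBC.
have R1R : R1 = R by apply/eqP; rewrite eqn_leq (rk1.2 _ rk.1) (rk.2 _ rk1.1).
move: R1R A1 B1 C1 A2 B2 C2 E1 E2 {rk1} => -> A1 B1 C1 A2 B2 C2 E1 E2.
exact: same_cpd_trans (same_factors kABC kBC E1) (same_factors kABC kBC E2).
Qed.

(** * The lines of minimal rank from a matrix pencil *)

(** Multilinearity of the determinant in the rows: a form of Cauchy-Binet in which rows are selected
    by arbitrary functions. *)
Lemma det_mul_expand (F : comNzRingType) m I (X : 'M[F]_(m, I)) (M : 'M[F]_(I, m)) :
  \det (X *m M) =
  \sum_(f : {ffun 'I_m -> 'I_I}) (\prod_i X i (f i)) * \det (rowsub f M).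
Proof.
rewrite /determinant; under [RHS]eq_bigr => f _ do rewrite mulr_sumr.
rewrite exchange_big; apply: eq_bigr => s _ /=.
under eq_bigr => i _ do rewrite mxE.
rewrite bigA_distr_bigA mulr_sumr; apply: eq_bigr => f _ /=.
rewrite big_split mulrCA; congr (_ * _); congr (_ * _).
by apply: eq_bigr => i _; rewrite mxE.
Qed.

Lemma det_mul2_expand (F : comNzRingType) m I J
    (X : 'M[F]_(m, I)) (M : 'M[F]_(I, J)) (Y : 'M[F]_(m, J)) :
  \det (X *m M *m Y^T) =
  \sum_(f : {ffun 'I_m -> 'I_I}) \sum_(g : {ffun 'I_m -> 'I_J})
     (\prod_i X i (f i)) * (\prod_i Y i (g i)) * \det (mxsub f g M).
Proof.
rewrite -mulmxA det_mul_expand; apply: eq_bigr => f _.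
rewrite -det_tr -mul_rowsub_mx trmx_mul trmxK det_mul_expand mulr_sumr.
apply: eq_bigr => g _; rewrite mulrA; congr (_ * _).
by rewrite -det_tr; congr (\det _); apply/matrixP => i j; rewrite !mxE.
Qed.

Lemma det_mxsub_eq0 (F : fieldType) m I J (N : 'M[F]_(I, J)) (f : 'I_m -> 'I_I)
    (g : 'I_m -> 'I_J) : (\rank N < m)%N -> \det (mxsub f g N) = 0.
Proof.
move=> rN; apply/eqP; apply: contraTT rN => d0; rewrite -leqNgt.
have : mxsub f g N \in unitmx by rewrite unitmxE unitfE.
rewrite -row_full_unit => /eqP <-.
have -> : mxsub f g N = rowsub f 1%:M *m N *m colsub g 1%:M.
  by rewrite mul_rowsub_mx mul1mx -mxsub_mul mulmx1.
exact: leq_trans (mxrankM_maxl _ _) (mxrankM_maxr _ _).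
Qed.

Section Pencil.
Variables (F : numFieldType) (I J k R n : nat).
Variables (A : 'M[F]_(I, R)) (B : 'M[F]_(J, R)) (C : 'M[F]_(k, R)).
Hypotheses (gpC : general_position C) (Rkn : R = (k + n)%N) (k1 : (1 < k)%N).
Hypotheses (kB : (n.+1 < krank B)%N) (kAB : (R + n.+1 < krank A + \rank B)%N).
Variable pt : {set 'I_R} -> 'rV[F]_k.
Hypothesis ptP :
  forall V : {set 'I_R}, #|V| = n.+1 -> forall r, ((pt V *m C) 0 r == 0) = (r \notin V).

Variables (Np : nat) (q : 'I_Np -> 'rV[F]_k).
Hypothesis qP : forall x, exists l : 'I_Np -> F, forall g, is_form n.+2 g ->
  g x = \sum_p l p * g (q p).

Let k0 : (0 < k)%N := ltnW k1.

(* As functionals on forms of degree [n.+2], such [l] annihilate the minors of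
   order [n.+2], whose span is that of the [hprod C U] with [#|U| = n.+2]. *)
Definition minor_kernel (l : 'cV[F]_Np) : Prop :=
  forall (f : {ffun 'I_n.+2 -> 'I_I}) (g : {ffun 'I_n.+2 -> 'I_J}),
    \sum_p \det (mxsub f g (core A B (q p *m C))) * l p 0 = 0.

(** By [det_core], [hprod C U] is a combination of minors of order [n.+2], which [l] kills. *)
Lemma minor_kernel_hprod l (U : {set 'I_R}) :
  minor_kernel l -> #|U| = n.+2 -> \sum_p l p 0 * hprod C U (q p) = 0.
Proof.
move=> lK Un; have kAB' : (R + n.+2 <= krank A + \rank B)%N by rewrite addnS.
have [X [Y XY]] := det_core Un kB kAB'.
under eq_bigr => p _ do rewrite /hprod -XY det_mul2_expand mulr_sumr.
rewrite exchange_big big1 // => f _ /=; under eq_bigr => p _ do rewrite mulr_sumr.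
rewrite exchange_big big1 // => g _ /=.
rewrite -[RHS](mulr0 ((\prod_i X i (f i)) * (\prod_i Y i (g i)))) -[in RHS](lK f g).
by rewrite mulr_sumr; apply: eq_bigr => p _; ring.
Qed.

(** By [qP], evaluation at [pt V] is a combination of evaluations at the [q p]. It kills the minors
    since the matrix at [pt V] has rank at most [n.+1]. *)
Lemma minor_kernel_pt (V : {set 'I_R}) : #|V| = n.+1 ->
  exists l : 'cV[F]_Np, minor_kernel l /\
    forall g, is_form n.+2 g -> g (pt V) = \sum_p l p 0 * g (q p).
Proof.
move=> Vn; have [l lP] := qP (pt V); exists (\col_p l p); split; last first.
  by move=> g /lP ->; apply: eq_bigr => p _; rewrite mxE.
move=> f g.
have fdet : is_form n.+2 (fun x => \det (mxsub f g (core A B (x *m C)))).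
  apply: form_ext (form_det (fun i j => C *m \col_r (A (f i) r * B (g j) r))) => x.
  congr (\det _); apply/matrixP => i j; rewrite [RHS]mxE coreE [LHS]mxE /linf mulmxA mxE.
  by apply: eq_bigr => r _; rewrite [(\col__ _) _ _]mxE; ring.
transitivity (\det (mxsub f g (core A B (pt V *m C)))).
  by rewrite (lP _ fdet); apply: eq_bigr => p _; rewrite mxE mulrC.
apply: det_mxsub_eq0; apply: leq_ltn_trans (rank_core_leq _ _ _) _.
rewrite ltnS -Vn; apply/subset_leq_card/subsetP => r.
by rewrite inE ptP // negbK.
Qed.

Definition lines : {set {set 'I_R}} := [set V : {set 'I_R} | #|V| == n.+1].
Definition line (j : 'I_#|lines|) : {set 'I_R} := enum_val j.

Lemma card_line j : #|line j| = n.+1.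
Proof. by have := enum_valP j; rewrite inE => /eqP. Qed.

Lemma line_onto (V : {set 'I_R}) : #|V| = n.+1 -> exists j, line j = V.
Proof.
move=> Vn; have VV : V \in lines by rewrite inE Vn.
by exists (enum_rank_in VV V); rewrite /line enum_rankK_in.
Qed.

Lemma big_line (f : {set 'I_R} -> F) :
  \sum_(V : {set 'I_R} | #|V| == n.+1) f V = \sum_j f (line j).
Proof.
rewrite -(big_enum_val f); apply: eq_bigl => V; by rewrite inE.
Qed.

Let Nf := #|{: {ffun 'I_n.+1 -> 'I_k}}|.

Definition point_monomials : 'M[F]_(Nf, #|lines|) :=
  \matrix_(f, j) mono (enum_val f) (pt (line j)).

(** Each column of [L] is a functional on forms; it is composed here with multiplication by the
    linear form [c] and recorded by its values on monomials of degree [n.+1]. *)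
Definition pencil_mx d (L : 'M[F]_(Np, d)) (c : 'cV[F]_k) : 'M[F]_(Nf, d) :=
  \matrix_(f, i) \sum_p L p i * (linf c (q p) * mono (enum_val f) (q p)).

Definition line_values (c : 'cV[F]_k) : 'rV[F]_#|lines| := \row_j linf c (pt (line j)).

(** Evaluations at the [pt V] are independent, since [hprod C V] vanishes at all of these points but
    one. *)
Lemma point_monomials_inj (z : 'cV[F]_#|lines|) : point_monomials *m z = 0 -> z = 0.
Proof.
move=> Hz; apply/colP => j; rewrite mxE.
have [a aE] : is_form n.+1 (hprod C (line j)).
  by rewrite -[X in is_form X](card_line j); apply: form_hprod.
have : \sum_j' z j' 0 * hprod C (line j) (pt (line j')) = 0.
  under eq_bigr => j' _ do rewrite aE mulr_sumr.
  rewrite exchange_big big1 // => f _ /=.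
  have /matrixP/(_ (enum_rank f) 0) := Hz; rewrite mxE [RHS]mxE => E.
  rewrite -[RHS](mulr0 (a f)) -[in RHS]E mulr_sumr; apply: eq_bigr => j' _.
  by rewrite mxE enum_rankK; ring.
rewrite (bigD1 j) //= big1 ?addr0.
  move/eqP; rewrite mulf_eq0 (hprod_pt ptP) ?card_line // eqxx orbF => /eqP //.
move=> j' j'j; apply/eqP; rewrite mulf_eq0 (hprod_pt ptP) ?card_line //.
by rewrite (inj_eq enum_val_inj) j'j orbT.
Qed.

(** By [functional_decomposition], the columns of [L] act as combinations of evaluations at the
    [pt V], with coefficients in [Mu]. Conversely, each such evaluation is a combination of the
    columns of [L], so [Mu] is row free. *)
Lemma pencil_factor d (L : 'M[F]_(Np, d)) :
  (forall i, minor_kernel (col i L)) ->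
  (forall l, minor_kernel l -> exists y, l = L *m y) ->
  exists2 Mu : 'M[F]_(#|lines|, d), row_free Mu &
    forall c, pencil_mx L c = point_monomials *m diag_mx (line_values c) *m Mu.
Proof.
move=> LK Lfull.
have /fin_all_exists[mu muP] : forall i, exists mu : {set 'I_R} -> F, forall c g,
    is_form n.+1 g -> \sum_p L p i * (linf c (q p) * g (q p)) =
    \sum_(V : {set 'I_R} | #|V| == n.+1) mu V * (linf c (pt V) * g (pt V)).
  move=> i; have [|mu muP] := functional_decomposition gpC Rkn k0 ptP
      (l := fun p => col i L p 0) (q := q).
    by move=> U Un; apply: minor_kernel_hprod.
  exists mu => c g gf; rewrite -muP //; apply: eq_bigr => p _; by rewrite mxE.
pose Mu : 'M[F]_(#|lines|, d) := \matrix_(j, i) mu i (line j).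
have E c : pencil_mx L c = point_monomials *m diag_mx (line_values c) *m Mu.
  apply/matrixP => f i; rewrite mxE muP; last exact: form_mono.
  rewrite big_line mxE; apply: eq_bigr => j _.
  by rewrite mul_mx_diag !mxE; ring.
exists Mu => //; apply/row_freeP.
(* A linear form vanishing at no [pt V] makes the diagonal factor invertible. *)
have [t tP] : exists t : nat, forall j, (moment F k t *m (pt (line j))^T) 0 0 != 0.
  have [|t tP] := @moment_avoid F _ xpredT _ (fun j => (pt (line j))^T).
    move=> j _; have /card_gt0P[r rV] : (0 < #|line j|)%N by rewrite card_line.
    apply: contraTneq rV => p0; rewrite -ptP ?card_line //.
    by rewrite -[pt _]trmxK p0 trmx0 mul0mx mxE.
  by exists t => j; apply: tP.
pose c := (moment F k t)^T.
have cj j : linf c (pt (line j)) != 0.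
  by rewrite /linf -[_ *m _]trmxK trmx_mul trmxK mxE.
have /fin_all_exists[y yP] : forall j, exists y : 'cV[F]_d,
    pencil_mx L c *m y = linf c (pt (line j)) *: col j point_monomials.
  move=> j; have [l [lK lE]] := minor_kernel_pt (card_line j).
  have [y yE] := Lfull l lK; exists y; apply/colP => f; rewrite [RHS]mxE mxE [col _ _ _ _]mxE mxE.
  have /= -> := lE _ (form_lin c (@form_mono _ _ _ (enum_val f))); rewrite yE.
  under [RHS]eq_bigr => p _ do rewrite mxE mulr_suml.
  rewrite exchange_big; apply: eq_bigr => i _ /=; rewrite mxE mulr_suml.
  by apply: eq_bigr => p _; ring.
exists (\matrix_(i, j) y j i 0); apply/matrixP => v j.
pose Y : 'cV_ _ := diag_mx (line_values c) *m (Mu *m y j - delta_mx j 0).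
have Y0 : Y = 0.
  apply: point_monomials_inj; rewrite /Y !mulmxBr !mulmxA -E yP.
  apply/eqP; rewrite subr_eq0; apply/eqP/colP => f.
  by rewrite -colE mul_mx_diag !mxE; ring.
have /matrixP/(_ v 0) := Y0; rewrite /Y mul_diag_mx !mxE => /eqP.
rewrite mulf_eq0 (negPf (cj v)) subr_eq0 eqxx andbT => /eqP <-.
by apply: eq_bigr => i _; rewrite !mxE.
Qed.

End Pencil.

(** * Generalized eigenvectors of a diagonalizable pencil *)

Section DiagonalPencil.
Variables (F : fieldType) (Nf N d : nat).
Variables (H : 'M[F]_(Nf, N)) (Mu : 'M[F]_(N, d)) (D0 D1 : 'rV[F]_N).
Hypotheses (H_inj : forall z : 'cV[F]_N, H *m z = 0 -> z = 0) (Mu_free : row_free Mu).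
Hypotheses (D00 : forall j, D0 0 j != 0).
Hypothesis D01 : forall i j, i != j -> D1 0 i * D0 0 j != D1 0 j * D0 0 i.

Let M0 := H *m diag_mx D0 *m Mu.
Let M1 := H *m diag_mx D1 *m Mu.

(** Both factors have rank [N], so the rectangular pencil can be cut down to a regular square
    one. *)
Lemma select_minor : exists (f : {ffun 'I_N -> 'I_Nf}) (g : {ffun 'I_N -> 'I_d}),
  rowsub f H \in unitmx /\ colsub g Mu \in unitmx.
Proof.
have Hfull : row_full H.
  rewrite -[row_full _]/(_ == _) -mxrank_tr; apply: inj_row_free => z zH.
  apply/trmx_inj; rewrite trmx0; apply: H_inj; apply/trmx_inj.
  by rewrite trmx_mul trmxK zH trmx0.
have Mfull : row_full Mu^T by rewrite -[row_full _]/(_ == _) mxrank_tr.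
exists (fullrankfun Hfull), (fullrankfun Mfull); split; first exact: fullrowsub_unit.
by rewrite -unitmx_tr trmx_mxsub; apply: fullrowsub_unit.
Qed.

Variables (f : 'I_N -> 'I_Nf) (g : 'I_N -> 'I_d).
Hypotheses (Hf : rowsub f H \in unitmx) (Mug : colsub g Mu \in unitmx).

Lemma mxsub_pencil (D : 'rV[F]_N) :
  mxsub f g (H *m diag_mx D *m Mu) = rowsub f H *m diag_mx D *m colsub g Mu.
Proof. by rewrite mxsub_mul -mul_rowsub_mx. Qed.

Lemma pencil_unit : mxsub f g M0 \in unitmx.
Proof.
rewrite mxsub_pencil !unitmx_mul Hf Mug andbT /=.
by rewrite unitmxE det_diag unitfE; apply/prodf_neq0.
Qed.

Lemma pencil_eigenvectors : exists (X : 'M[F]_N) (e : 'rV[F]_N),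
  X \in unitmx /\ mxsub f g M1 *m X = mxsub f g M0 *m X *m diag_mx e.
Proof.
exists (invmx (colsub g Mu)), (\row_j (D1 0 j / D0 0 j)).
rewrite unitmx_inv Mug; split=> //.
rewrite !mxsub_pencil !mulmxK // -mulmxA; congr (_ *m _).
apply/matrixP => i j; rewrite mul_diag_mx !mxE; case: (i =P j) => [->|_].
  by rewrite !mulr1n mulrCA divff ?mulr1.
by rewrite !mulr0n mulr0.
Qed.

(** In the coordinates [W = colsub g Mu *m X] the pencil is diagonal with distinct ratios of [D1] to
    [D0], so each column of [W] has one nonzero entry. Using all rows of [M0], not only those in
    [f], returns full columns of [H]. *)
Lemma eigenvectors_pencil (X : 'M[F]_N) (e : 'rV[F]_N) :
  X \in unitmx -> mxsub f g M1 *m X = mxsub f g M0 *m X *m diag_mx e ->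
  exists s : 'I_N -> 'I_N, (forall v, exists j, s j = v) /\
    forall j, exists2 a, a != 0 & col j (colsub g M0 *m X) = a *: col (s j) H.
Proof.
move=> Xu; rewrite !mxsub_pencil -2!mulmxA -!(mulmxA (_ *m _)) -!mulmxA.
have [W defW] : exists W, W = colsub g Mu *m X by exists (colsub g Mu *m X).
rewrite (mulmxA (colsub g Mu)) -defW => /(can_inj (mulKmx Hf)) E.
have Wu : W \in unitmx by rewrite defW unitmx_mul Mug.
have WE v j : W v j != 0 -> D1 0 v = D0 0 v * e 0 j.
  move=> W0; apply: (mulIf W0); have /matrixP/(_ v j) := E.
  by rewrite !mul_diag_mx mul_mx_diag !mxE => ->; rewrite mulrAC mulrA.
have W_uniq u v j : W u j != 0 -> W v j != 0 -> u = v.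
  move=> /WE Eu /WE Ev; apply: contraTeq isT => /D01 /negP[]; apply/eqP.
  by rewrite Eu Ev; ring.
have /fin_all_exists[s sP] : forall j, exists v, W v j != 0.
  move=> j; apply/existsP; apply: contraT; rewrite negb_exists => /forallP W0.
  have : W *m delta_mx j (0 : 'I_1) = 0.
    rewrite -colE; apply/colP => v; rewrite !mxE; apply/eqP.
    by have := W0 v; rewrite negbK.
  move=> /(congr1 (mulmx (invmx W))); rewrite mulKmx // mulmx0 => /matrixP/(_ j 0).
  by rewrite !mxE !eqxx => /eqP; rewrite oner_eq0.
exists s; split=> [v|j].
  suff /existsP[j Wj] : [exists j, W v j != 0] by exists j; apply: W_uniq (sP j) Wj.
  apply: contraT; rewrite negb_exists => /forallP W0.
  have : delta_mx (0 : 'I_1) v *m W = 0.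
    rewrite -rowE; apply/rowP => j; rewrite !mxE; apply/eqP.
    by have := W0 j; rewrite negbK.
  move=> /(congr1 (mulmx^~ (invmx W))); rewrite mulmxK // mul0mx => /matrixP/(_ 0 v).
  by rewrite !mxE !eqxx => /eqP; rewrite oner_eq0.
exists (D0 0 (s j) * W (s j) j); first by rewrite mulf_neq0.
have -> : colsub g M0 *m X = H *m (diag_mx D0 *m W).
  by rewrite -mulmx_colsub defW !mulmxA.
apply/colP => i; rewrite !mxE (bigD1 (s j)) //= big1 ?addr0.
  by rewrite mul_diag_mx mxE mulrC.
move=> v vs; rewrite mul_diag_mx mxE; have [->|/W_uniq/(_ (sP j))/eqP] := eqVneq (W v j) 0.
  by rewrite !mulr0.
by rewrite (negPf vs).
Qed.

End DiagonalPencil.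

(** With [i] fixed and [x 0 i != 0], these monomials recover [x] up to a scalar. *)
Lemma mono_ray (F : fieldType) k n (i a : 'I_k) (x : 'rV[F]_k) :
  mono [ffun l : 'I_n.+1 => if l == ord0 then a else i] x = x 0 a * x 0 i ^+ n.
Proof.
rewrite /mono big_ord_recl ffunE eqxx; congr (_ * _).
rewrite (eq_bigr (fun=> x 0 i)) ?prodr_const ?card_ord // => l _.
by rewrite ffunE.
Qed.

(** * Columns as common rays of column spaces *)

Section CommonRays.
Variables (F : fieldType) (I J R N n : nat).
Variables (A : 'M[F]_(I, R)) (M : 'I_N -> 'M[F]_(I, J)) (V : 'I_N -> {set 'I_R}).
Hypotheses (nR : (n.+1 < R)%N) (kA : (n.+1 < krank A)%N).
Hypothesis V_onto : forall W : {set 'I_R}, #|W| = n.+1 -> exists j, V j = W.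
Hypothesis M_sub : forall j (y : 'cV[F]_J),
  exists2 z : 'cV[F]_R, (forall r, r \notin V j -> z r 0 = 0) & M j *m y = A *m z.
Hypothesis M_sup : forall j r, r \in V j -> exists y : 'cV[F]_J, col r A = M j *m y.

(** On the left the coordinates of the vectors [v_r], on the right those of the [y_(r,j)] that
    express [v_r] by the columns of [M j]. *)
Definition ray_var : predArgType := ('I_R * 'I_I + 'I_R * 'I_N * 'I_J)%type.
Definition ray_eqn : predArgType := ('I_R * 'I_N * 'I_I)%type.

(* The transpose of the linear system [v_r = M_j y_(r,j)], for [(r, j)] in [S]. *)
Definition ray_system (S : {set 'I_R * 'I_N}) : 'M[F]_(#|{: ray_var}|, #|{: ray_eqn}|) :=
  \matrix_(z, e) let: (r, j, i) := enum_val e in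
    if (r, j) \in S then
      match enum_val z with
      | inl ri => (ri == (r, i))%:R
      | inr rjl => if (rjl.1.1 == r) && (rjl.1.2 == j) then - M j i rjl.2 else 0
      end
    else 0.

Definition ray_part d (X : 'M[F]_(#|{: ray_var}|, d)) r c : 'cV[F]_I :=
  \col_i X (enum_rank (inl (r, i) : ray_var)) c.

Definition aux_part d (X : 'M[F]_(#|{: ray_var}|, d)) r j c : 'cV[F]_J :=
  \col_l X (enum_rank (inr (r, j, l) : ray_var)) c.

Lemma ray_systemP S d (X : 'M[F]_(#|{: ray_var}|, d)) :
  (ray_system S)^T *m X = 0 <->
  forall r j c, (r, j) \in S -> ray_part X r c = M j *m aux_part X r j c.
Proof.
have E r j i c : ((ray_system S)^T *m X) (enum_rank ((r, j, i) : ray_eqn)) c =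
    if (r, j) \in S then (ray_part X r c - M j *m aux_part X r j c) i 0 else 0.
  rewrite mxE (reindex enum_rank) /=; last first.
    by exists enum_val => ? _; rewrite ?enum_rankK ?enum_valK.
  under eq_bigr => z _ do rewrite !mxE !enum_rankK.
  case: ifP => rjS; last by rewrite big1 // => z _; rewrite mul0r.
  rewrite [RHS]mxE big_sumType /=; congr (_ + _).
    rewrite (bigD1 (r, i)) //= eqxx mul1r mxE big1 ?addr0 // => z /negPf ->.
    by rewrite mul0r.
  transitivity (\sum_(p : 'I_R * 'I_N) \sum_(l < J)
      (if (p.1 == r) && (p.2 == j) then - M j i l else 0)
      * X (enum_rank (inr (p, l) : ray_var)) c).
    by rewrite pair_bigA; apply: eq_bigr => [[p l] _].
  rewrite (bigD1 (r, j)) //= !eqxx [X in _ + X]big1 ?addr0 => [|p pE].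
    by rewrite !mxE -sumrN; apply: eq_bigr => l _; rewrite mxE mulNr.
  rewrite big1 // => l _; case: ifP; last by rewrite mul0r.
  by case/andP => /eqP p1 /eqP p2; case/eqP: pE; rewrite -p1 -p2; case: p {p1 p2}.
split=> [H r j c rjS | H].
  apply/eqP; rewrite -subr_eq0; apply/eqP/colP => i.
  by have /matrixP/(_ (enum_rank ((r, j, i) : ray_eqn)) c) := H; rewrite E rjS => ->; rewrite !mxE.
apply/matrixP => e c; rewrite -[e]enum_valK; case: (enum_val e) => [[r j] i].
by rewrite E [RHS]mxE; case: ifP => // rjS; rewrite (H _ _ _ rjS) subrr mxE.
Qed.

(** By [common_column], each solution has [v_r] on the line of [col r A]. Some column of [X] has
    [v_r] nonzero, because [col r A] itself extends to a solution, by zero at the other indices. *)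
Lemma common_rays d (X : 'M[F]_(#|{: ray_var}|, d)) :
  let S := [set rj : 'I_R * 'I_N | rj.1 \in V rj.2] in
  (ray_system S)^T *m X = 0 ->
  (forall z : 'cV[F]_#|{: ray_var}|, (ray_system S)^T *m z = 0 -> exists y, z = X *m y) ->
  exists c : {ffun 'I_R -> 'I_d}, forall r,
    exists2 a, a != 0 & ray_part X r (c r) = a *: col r A.
Proof.
move=> S XS Xfull.
have rayA r c : exists a, ray_part X r c = a *: col r A.
  apply: (common_column nR kA) => W Wn rW; have [j jW] := V_onto Wn.
  have := (ray_systemP S X).1 XS r j c; rewrite inE /= jW => /(_ rW) ->.
  by have [z zV ->] := M_sub j (aux_part X r j c); exists z; rewrite // -jW.
have A0 r : col r A != 0 by apply: krank_col_neq0; apply: leq_ltn_trans kA.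
suff cP r : exists c, ray_part X r c != 0.
  have /fin_all_exists[c cE] := cP; exists [ffun r => c r] => r; rewrite ffunE.
  have [a aE] := rayA r (c r); exists a => //.
  by apply: contraNneq (cE r) => a0; rewrite aE a0 scale0r.
have /fin_all_exists[y yP] : forall j, exists y : 'cV[F]_J, r \in V j -> col r A = M j *m y.
  move=> j; case: (boolP (r \in V j)) => [/M_sup[y yE]|_]; last by exists 0.
  by exists y.
pose z : 'cV[F]_#|{: ray_var}| := \col_i match enum_val i with
  | inl ri => if ri.1 == r then A ri.2 r else 0
  | inr rjl => if rjl.1.1 == r then y rjl.1.2 rjl.2 0 else 0 end.
have [|w zw] := Xfull z.
  apply/ray_systemP => r' j c; rewrite inE /= => r'V; rewrite ord1.
  have [r'r|r'r] := eqVneq r' r.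
    rewrite r'r in r'V *.
    have -> : ray_part z r 0 = col r A by apply/colP => i; rewrite !mxE enum_rankK /= eqxx.
    have -> : aux_part z r j 0 = y j by apply/colP => i; rewrite !mxE enum_rankK /= eqxx.
    exact: yP.
  have -> : ray_part z r' 0 = 0.
    by apply/colP => i; rewrite !mxE enum_rankK /= (negPf r'r).
  have -> : aux_part z r' j 0 = 0.
    by apply/colP => i; rewrite !mxE enum_rankK /= (negPf r'r).
  by rewrite mulmx0.
apply/existsP; apply: contraNT (A0 r); rewrite negb_exists => /forallP X0.
apply/eqP/colP => i; have /matrixP/(_ (enum_rank (inl (r, i) : ray_var)) 0) := zw.
rewrite !mxE enum_rankK /= eqxx => ->; apply: big1 => c _.
have := X0 c; rewrite negbK => /eqP/matrixP/(_ i 0); rewrite !mxE => ->.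
by rewrite mul0r.
Qed.

End CommonRays.

Lemma eq_ray_system (F : fieldType) I J R N (M M' : 'I_N -> 'M[F]_(I, J))
    (S : {set 'I_R * 'I_N}) :
  M =1 M' -> ray_system M S = ray_system M' S.
Proof.
move=> MM'; apply/matrixP => z e; rewrite !mxE; case: (enum_val e) => [[r j] i].
by case: (enum_val z) => // rjl; rewrite MM'.
Qed.

(** * Expressions and strategies *)

Section Expressions.
Variables (I J K : nat).
Local Notation expr := (expr I J K).

Definition int_expr (z : int) : expr 1 1 := Const I J K z%:M.

Definition sum_expr (S : finType) m n (f : S -> expr m n) : expr m n :=
  foldr (fun x e => Add (f x) e) (Const I J K 0) (enum S).

Fact id_ksub_subproof m :
  let f := [ffun i : 'I_m => i] in
  [forall i : 'I_m, forall j : 'I_m, (i < j)%N ==> (f i < f j)%N].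
Proof. by apply/forallP => i; apply/forallP => j; rewrite !ffunE implybb. Qed.

Definition id_ksub m : ksub m m := exist _ [ffun i => i] (id_ksub_subproof m).

(** The compound of order [m] of a square matrix of size [m] has the determinant as its only
    entry. *)
Definition det_expr m (e : expr m m) : expr 1 1 :=
  Entry (Compound m e) (enum_rank (id_ksub m)) (enum_rank (id_ksub m)).

Definition contract_expr (c : 'I_K -> expr 1 1) : expr I J :=
  sum_expr (fun l => Scale (c l) (Slice I J l)).

Variables (F : realType) (T : tensor F I J K) (s : store F).

Lemma eval_int z : eval T s (int_expr z) 0 0 = z%:~R.
Proof. by rewrite !mxE. Qed.

Lemma eval_sum (S : finType) m n (f : S -> expr m n) :
  eval T s (sum_expr f) = \sum_x eval T s (f x).
Proof.
rewrite -[RHS]big_enum /sum_expr /=; elim: (enum S) => [|x r IH] /=.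
  by rewrite big_nil; apply/matrixP => i j; rewrite !mxE.
by rewrite big_cons IH.
Qed.

Lemma eval_det m (e : expr m m) : eval T s (det_expr e) 0 0 = \det (eval T s e).
Proof.
rewrite /= !mxE enum_rankK /= mulr1n; congr (\det _).
by apply/matrixP => i j; rewrite mxE !ffunE.
Qed.

Lemma eval_contract c :
  eval T s (contract_expr c) = contract T (\row_l eval T s (c l) 0 0).
Proof. by rewrite eval_sum; apply: eq_bigr => l _; rewrite mxE. Qed.

Lemma eval_mul (a b : expr 1 1) : eval T s (Mul a b) 0 0 = eval T s a 0 0 * eval T s b 0 0.
Proof. by rewrite /= mxE big_ord1. Qed.

Lemma eval_entry m n (e : expr m n) i j : eval T s (Entry e i j) 0 0 = eval T s e i j.
Proof. by rewrite /= !mxE. Qed.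

Lemma eval_build m n (f : 'I_m -> 'I_n -> expr 1 1) i j :
  eval T s (Build f) i j = eval T s (f i j) 0 0.
Proof. by rewrite /= mxE. Qed.

End Expressions.

(** * Backtracking search *)

Section Strategies.
Variables (I J K : nat).

(* A strategy turns the continuation to be run on failure into a procedure. *)
Definition strategy := procedure I J K -> procedure I J K.

Definition search (S : finType) (f : S -> strategy) : strategy :=
  fun q => foldr f q (enum S).

Definition with_kernel n m d x (e : expr I J K n m) (k : strategy) : strategy :=
  fun q => OrthCompl d x e (k q) q.

Definition with_eigenvectors n x (a b : expr I J K n n) (k : strategy) : strategy :=
  fun q => Gevd x x.+1 a b (k q) q.

Definition solve_last R m x (A : expr I J K I R) (B : expr I J K J R)
    (a : expr I J K m R) (b : expr I J K m K) : strategy :=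
  fun q => Solve x a b (Return A B (Tr (Reg I J K R K x))) q.

Variables (F : realType) (T : tensor F I J K).
Variable Q : forall N, 'M[F]_(I, N) -> 'M[F]_(J, N) -> 'M[F]_(K, N) -> Prop.

Definition agree (n : nat) (s s' : store F) : Prop :=
  forall m p x, (x < n)%N -> s' m p x = s m p x.

(** Failed choices may have overwritten the registers from [n] on, so nothing is assumed about
    them. *)
Definition robust (n : nat) (s : store F) (p : procedure I J K) : Prop :=
  forall s', agree n s s' -> guaranteed T Q p s'.

(* Registers below [n] are preserved, so that a failed attempt does not disturb
   the attempts that follow. *)
Definition safe n (k : strategy) : Prop := forall s q, robust n s q -> robust n s (k q).

Definition good n s (k : strategy) : Prop := forall q, robust n s (k q).

Lemma agree_refl n s : agree n s s. Proof. by []. Qed.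

Lemma agree_trans n s1 s2 s3 : agree n s1 s2 -> agree n s2 s3 -> agree n s1 s3.
Proof. by move=> a12 a23 m p x xn; rewrite a23 // a12. Qed.

Lemma agree_weak n n' s s' : (n <= n')%N -> agree n' s s' -> agree n s s'.
Proof. by move=> nn' a m p x xn; apply: a; apply: leq_trans nn'. Qed.

Lemma agree_update n s m p x (M : 'M[F]_(m, p)) : (n <= x)%N -> agree n s (update s x M).
Proof.
by move=> nx m' p' y yn; rewrite /update; case: eqP => // E; move: nx; rewrite leqNgt -E yn.
Qed.

Lemma robust_agree n s s' p : agree n s s' -> robust n s p -> robust n s' p.
Proof. by move=> a r s'' a'; apply: r; apply: agree_trans a a'. Qed.

Lemma robust_weak n n' s p : (n <= n')%N -> robust n s p -> robust n' s p.
Proof. by move=> nn' r s' a; apply: r; apply: agree_weak a. Qed.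

Lemma update_same s m p x (M : 'M[F]_(m, p)) : update s x M m p x = M.
Proof. by rewrite /update eqxx conform_mx_id. Qed.

Lemma search_safe n (S : finType) (f : S -> strategy) :
  (forall x, safe n (f x)) -> safe n (search f).
Proof.
move=> fs s q rq; rewrite /search; elim: (enum S) => //= x r IH.
exact: fs.
Qed.

(** Alternatives before [x] are harmless by safety; those after it belong to its failure
    continuation, which is arbitrary in [good]. *)
Lemma search_good n s (S : finType) (f : S -> strategy) x :
  (forall y, safe n (f y)) -> good n s (f x) -> good n s (search f).
Proof.
move=> fs fx q; rewrite /search; have := mem_enum S x; elim: (enum S) => //= y r IH.
by rewrite inE => /orP[/eqP <-|/IH /fs].
Qed.

Lemma with_kernel_safe n m d x (e : expr I J K n m) k :
  safe x.+1 k -> safe x (with_kernel d x e k).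
Proof.
move=> ks s q rq s' a; have rq' := robust_agree a rq.
split=> [X _|_]; last exact: rq.
apply: (ks _ _ (robust_weak (leqnSn x) (robust_agree (agree_update s' X (leqnn x)) rq'))).
exact: agree_refl.
Qed.

(** One basis of the right dimension rules out the failure branch; the continuation must cope with
    whichever basis is delivered. *)
Lemma with_kernel_good n m d x (e : expr I J K n m) k s :
  (forall s', agree x s s' ->
     (exists X : 'M[F]_(n, d), orth_compl (eval T s' e) X) /\
     (forall X : 'M[F]_(n, d), orth_compl (eval T s' e) X -> good x.+1 (update s' x X) k)) ->
  good x s (with_kernel d x e k).
Proof.
move=> H q s' a; have [[X XP] kP] := H s' a; split=> [X' X'P | H']; last by case: (H' X).
by apply: (kP X' X'P q); apply: agree_refl.
Qed.

Lemma with_eigenvectors_safe n x (a b : expr I J K n n) k :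
  safe x.+2 k -> safe x (with_eigenvectors x a b k).
Proof.
move=> ks s q rq s' ag; have rq' := robust_agree ag rq.
split=> [X d _|_]; last exact: rq.
apply: (ks (update (update s' x X) x.+1 d) q _ _ (agree_refl _)).
apply: (@robust_weak x); first by rewrite -addn2 leq_addr.
apply: robust_agree rq'; apply: agree_trans (agree_update s' X (leqnn x)) _.
exact: agree_update.
Qed.

Lemma with_eigenvectors_good n x (a b : expr I J K n n) k s :
  (forall s', agree x s s' ->
     (exists X d, gevd (eval T s' a) (eval T s' b) X d) /\
     (forall X d, gevd (eval T s' a) (eval T s' b) X d ->
        good x.+2 (update (update s' x X) x.+1 d) k)) ->
  good x s (with_eigenvectors x a b k).
Proof.
move=> H q s' ag; have [[X [d XP]] kP] := H s' ag.
split=> [X' d' XP' | H']; last by case: (H' X d).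
by apply: (kP X' d' XP' q); apply: agree_refl.
Qed.

End Strategies.

Lemma orth_compl_exists (F : realType) n m (M : 'M[F]_(n, m)) :
  exists (d : 'I_n.+1) (X : 'M[F]_(n, d)), orth_compl M X.
Proof.
have dn : (n - \rank M < n.+1)%N by rewrite ltnS leq_subr.
exists (Ordinal dn) => /=; have E : \rank (kermx M) = (n - \rank M)%N by rewrite mxrank_ker.
exists (castmx (E, erefl n) (row_base (kermx M)))^T; split.
- apply/trmx_inj; rewrite trmx_mul !trmxK trmx0; apply/sub_kermxP.
  by case: _ / E; rewrite castmx_id eq_row_base.
- by rewrite mxrank_tr; case: _ / E; rewrite castmx_id; apply/eqP/row_base_free.
- by rewrite subnKC // rank_leq_row.
Qed.

Lemma orth_compl_full (F : realType) n m d (M : 'M[F]_(n, m)) (X : 'M[F]_(n, d)) (z : 'cV[F]_n) :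
  orth_compl M X -> M^T *m z = 0 -> exists y, z = X *m y.
Proof.
move=> [MX rX rM] Mz.
have /submxP[y zy] : (z^T <= X^T)%MS.
  have Xker : (X^T <= kermx M)%MS.
    by apply/sub_kermxP/trmx_inj; rewrite trmx_mul trmxK MX trmx0.
  have [_] := mxrank_leqif_eq Xker; rewrite mxrank_ker mxrank_tr rX.
  have -> : (n - \rank M)%N = d.
    by apply/eqP; rewrite -(eqn_add2l (\rank M)) rM subnKC // rank_leq_row.
  rewrite eqxx => /esym/eqmxP ->; apply/sub_kermxP/trmx_inj.
  by rewrite trmx_mul trmxK Mz trmx0.
by exists y^T; rewrite -[z]trmxK zy trmx_mul trmxK.
Qed.

(** * The procedure *)

Section Attempt.
Variables (I J K R k n : nat).
Local Notation expr := (expr I J K).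
Local Notation N := #|lines R n|.
Local Notation Np := #|{: {ffun 'I_k -> 'I_n.+3}}|.
Local Notation Nf := #|{: {ffun 'I_n.+1 -> 'I_k}}|.
Local Notation Nm := #|{: {ffun 'I_n.+2 -> 'I_I} * {ffun 'I_n.+2 -> 'I_J}}|.

Definition grid (p : 'I_Np) : 'rV[int]_k := \row_a (enum_val p a)%:R.

(** Rows are grid points and columns are minors, so the orthogonal complement of the column space is
    the space [minor_kernel]. *)
Definition minors_expr (Phi : 'M[int]_(k, K)) : expr Np Nm :=
  Build (fun p (fg : 'I_Nm) => det_expr (Build (fun i j =>
    Entry (contract_expr (I := I) (J := J)
        (fun l => int_expr I J K ((grid p *m Phi) 0 l)))
      ((enum_val fg).1 i) ((enum_val fg).2 j)))).

Definition pencil_expr d (c : 'cV[int]_k) : expr Nf d :=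
  Build (fun (f : 'I_Nf) i => sum_expr (fun p : 'I_Np =>
    Mul (Entry (Reg I J K Np d 0) p i)
      (int_expr I J K ((grid p *m c) 0 0 * \prod_l grid p 0 (enum_val f l))))).

Definition sub_expr m p m' p' (f : 'I_m' -> 'I_m) (g : 'I_p' -> 'I_p) (e : expr m p) :
    expr m' p' :=
  Build (fun i j => Entry e (f i) (g j)).

(* The index of the monomial [x_a * x_i ^ n]. *)
Definition ray_index (i a : 'I_k) : 'I_Nf :=
  enum_rank [ffun l : 'I_n.+1 => if l == ord0 then a else i].

(** The eigenvectors in register 1 turn the pencil into multiples of the monomial vectors of the
    [pt V]. The entries at [x_a * x_i ^ n] give a multiple of the point, which [Phi] carries to a
    contraction vector. *)
Definition line_slice (Phi : 'M[int]_(k, K)) d (c : 'cV[int]_k) (g : 'I_N -> 'I_d)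
    (i : 'I_N -> 'I_k) (j : 'I_N) : expr I J :=
  contract_expr (fun l => sum_expr (fun a =>
    Mul (Entry (Mul (sub_expr id g (pencil_expr d c)) (Reg I J K N N 1))
           (ray_index (i j) a) j)
      (int_expr I J K (Phi a l)))).

Definition ray_expr m p (M : 'I_N -> expr m p) (S : {set 'I_R * 'I_N}) :
    expr #|{: ray_var m p R N}| #|{: ray_eqn m R N}| :=
  Build (fun (z : 'I_#|{: ray_var m p R N}|) (e : 'I_#|{: ray_eqn m R N}|) =>
    let: (r, j, i) := enum_val e in
    if (r, j) \in S then
      match enum_val z with
      | inl ri => int_expr I J K (ri == (r, i))%:Z
      | inr rjl => if (rjl.1.1 == r) && (rjl.1.2 == j)
                   then Mul (int_expr I J K (-1)) (Entry (M j) i rjl.2)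
                   else int_expr I J K 0
      end
    else int_expr I J K 0).

Definition factor_expr m p d x (c : 'I_R -> 'I_d) : expr m R :=
  Build (fun i r => Entry (Reg I J K #|{: ray_var m p R N}| d x)
    (enum_rank (inl (r, i) : ray_var m p R N)) (c r)).

Definition khatri_rao_expr (A : expr I R) (B : expr J R) : expr #|{: 'I_I * 'I_J}| R :=
  Build (fun (ij : 'I_#|{: 'I_I * 'I_J}|) r =>
    Mul (Entry A (enum_val ij).1 r) (Entry B (enum_val ij).2 r)).

Definition unfolding_expr : expr #|{: 'I_I * 'I_J}| K :=
  Build (fun (ij : 'I_#|{: 'I_I * 'I_J}|) l => Entry (Slice I J l) (enum_val ij).1 (enum_val ij).2).

(* A solution of the linear system for the third factor certifies that the tensor
   is the polyadic sum, so nothing remains to be verified. *)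
Definition factors_stage dA dB : strategy I J K :=
  search (fun cA : {ffun 'I_R -> 'I_dA} => search (fun cB : {ffun 'I_R -> 'I_dB} =>
    let A := factor_expr I J 3 cA in let B := factor_expr J I 4 cB in
    solve_last 5 A B (khatri_rao_expr A B) unfolding_expr)).

(** [i] guesses a nonzero coordinate of each point, [S] the incidence of columns and points, [dA]
    and [dB] the dimensions of the solution spaces. *)
Definition rays_stage (M : ('I_N -> 'I_k) -> 'I_N -> expr I J) : strategy I J K :=
  search (fun i : {ffun 'I_N -> 'I_k} => search (fun S : {set 'I_R * 'I_N} =>
  search (fun dA : 'I_#|{: ray_var I J R N}|.+1 =>
  search (fun dB : 'I_#|{: ray_var J I R N}|.+1 =>
    with_kernel dA 3 (ray_expr (M i) S)
      (with_kernel dB 4 (ray_expr (fun j => Tr (M i j)) S)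
        (factors_stage dA dB)))))).

(** [f] and [g] guess an invertible square submatrix of the pencil at [c0]. *)
Definition pencil_stage (Phi : 'M[int]_(k, K)) (c0 c1 : 'cV[int]_k) d : strategy I J K :=
  search (fun f : {ffun 'I_N -> 'I_Nf} => search (fun g : {ffun 'I_N -> 'I_d} =>
    with_eigenvectors 1 (sub_expr f g (pencil_expr d c1)) (sub_expr f g (pencil_expr d c0))
      (rays_stage (line_slice Phi c0 g)))).

(* Finitely many integer projections and pencils replace the random ones: for
   every tensor of the theorem one of them is generic. *)
Definition attempt : strategy I J K :=
  search (fun t : {ffun 'I_k -> 'I_(#|{set 'I_R}| * K).+1} =>
  search (fun t0 : 'I_(#|{: 'I_N}| * k).+1 => search (fun t1 : 'I_(#|{: 'I_N * 'I_N}| * k).+1 =>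
  search (fun d : 'I_Np.+1 =>
    let Phi := vandermonde int K (val \o t) in
    with_kernel d 0 (minors_expr Phi)
      (pencil_stage Phi (moment int k t0)^T (moment int k t1)^T d))))).

End Attempt.

(** * Values of the expressions *)

Section Correctness.
Variables (F : realType) (I J K : nat) (T : tensor F I J K).

Lemma unfolding_solution R (s : store F) (A : expr I J K I R) (B : expr I J K J R)
    (X : 'M[F]_(R, K)) :
  eval T s (khatri_rao_expr A B) *m X = eval T s (unfolding_expr I J K) <->
  T = polyadic (eval T s A) (eval T s B) X^T.
Proof.
have E i j l : (eval T s (khatri_rao_expr A B) *m X) (enum_rank (i, j)) l =
    polyadic (eval T s A) (eval T s B) X^T (i, j, l).
  rewrite mxE polyadicE; apply: eq_bigr => r _.
  by rewrite eval_build eval_mul !eval_entry enum_rankK [X^T _ _]mxE.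
have E' i j l : eval T s (unfolding_expr I J K) (enum_rank (i, j)) l = T (i, j, l).
  by rewrite eval_build eval_entry enum_rankK mxE.
split=> [H | H].
  by apply/ffunP => -[[i j] l]; rewrite -E -E' H.
apply/matrixP => ij l; rewrite -[ij]enum_valK; case: (enum_val ij) => i j.
by rewrite E E' -H.
Qed.

Lemma eval_factor R n m p d x (c : 'I_R -> 'I_d) (s : store F) r :
  col r (eval T s (@factor_expr I J K R n m p d x c)) =
  ray_part (s #|{: ray_var m p R #|lines R n|}| d x) r (c r).
Proof. by apply/colP => i; rewrite mxE eval_build eval_entry mxE. Qed.

Lemma eval_int_contract (s : store F) (y : 'rV[int]_K) :
  eval T s (contract_expr (I := I) (J := J) (fun l => int_expr I J K (y 0 l))) =
  contract T (map_mx intr y).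
Proof.
rewrite eval_contract; congr (contract _ _); apply/rowP => l.
by rewrite mxE eval_int mxE.
Qed.

Lemma eval_minors k n (Phi : 'M[int]_(k, K)) s p fg :
  eval T s (minors_expr I J n Phi) p fg =
  \det (mxsub (enum_val fg).1 (enum_val fg).2
         (contract T (map_mx intr (grid p) *m map_mx intr Phi))).
Proof.
rewrite eval_build eval_det; congr (\det _); apply/matrixP => i j.
by rewrite eval_build eval_entry eval_int_contract map_mxM [RHS]mxE.
Qed.

Lemma eval_pencil k n d (c : 'cV[int]_k) s :
  eval T s (pencil_expr I J K n d c) =
  pencil_mx n (fun p => map_mx intr (grid (k := k) (n := n) p)) (s _ d 0) (map_mx intr c).
Proof.
apply/matrixP => f i; rewrite eval_build eval_sum summxE mxE; apply: eq_bigr => p _.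
rewrite eval_mul eval_entry eval_int rmorphM rmorph_prod; congr (_ * (_ * _)).
  by rewrite /linf -map_mxM [RHS]mxE.
by apply: eq_bigr => l _; rewrite [RHS]mxE.
Qed.

Lemma eval_line_slice R k n (Phi : 'M[int]_(k, K)) d (c : 'cV[int]_k)
    (g : 'I_#|lines R n| -> 'I_d) i j s :
  eval T s (line_slice I J Phi c g i j) =
  contract T (\row_a (colsub g
    (pencil_mx n (fun p => map_mx intr (grid (k := k) (n := n) p)) (s _ d 0)
    (map_mx intr c)) *m s _ _ 1) (ray_index n (i j) a) j *m map_mx intr Phi).
Proof.
rewrite eval_contract; congr (contract _ _); apply/rowP => l.
rewrite mxE eval_sum summxE mxE; apply: eq_bigr => a _.
rewrite eval_mul eval_entry eval_int [X in _ = X * _]mxE [X in _ = _ * X]mxE.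
congr (_ * _).
rewrite -[eval _ _ _]/(eval T s (sub_expr id g (pencil_expr I J K n d c)) *m s _ _ 1).
rewrite mxE [RHS]mxE; apply: eq_bigr => v _; congr (_ * _).
by rewrite eval_build eval_entry eval_pencil [RHS]mxE.
Qed.

Lemma eval_ray R n m p (M : 'I_#|lines R n| -> expr I J K m p) S s :
  eval T s (ray_expr M S) = ray_system (fun j => eval T s (M j)) S.
Proof.
apply/matrixP => z e; rewrite eval_build mxE; case: (enum_val e) => [[r j] i].
case: ifP => _; last by rewrite eval_int.
case: (enum_val z) => [ri|rjl]; first by rewrite eval_int.
case: ifP => _; last by rewrite eval_int.
by rewrite eval_mul eval_entry eval_int mulrN1z mulN1r.
Qed.

End Correctness.

(** * The search succeeds *)

Section Guarantee.
Variables (F : realType) (I J K R : nat).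
Variables (A : 'M[F]_(I, R)) (B : 'M[F]_(J, R)) (C : 'M[F]_(K, R)).
Hypothesis kABC : (2 * R + 2 <= krank A + \rank B + krank C)%N.
Hypothesis kBC : (R + 2 <= krank B + krank C)%N.

Let T := polyadic A B C.
Let Q N (A' : 'M[F]_(I, N)) (B' : 'M[F]_(J, N)) (C' : 'M[F]_(K, N)) := is_cpd T A' B' C'.
Local Notation safe := (safe T Q).
Local Notation good := (good T Q).

Lemma cpd_of_polyadic R' (A' : 'M[F]_(I, R')) (B' : 'M[F]_(J, R')) (C' : 'M[F]_(K, R')) :
  (R' <= R)%N -> T = polyadic A' B' C' -> Q A' B' C'.
Proof.
move=> R'R E; have /eqP R'E : R' == R by rewrite eqn_leq R'R (terms_min kABC kBC E).
by move: A' B' C' E {R'R}; rewrite R'E => A' B' C'; apply: exact_terms.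
Qed.

Section Leaf.
Variables (R' n dA dB : nat) (cA : 'I_R' -> 'I_dA) (cB : 'I_R' -> 'I_dB).
Hypothesis R'R : (R' <= R)%N.

Let EA := @factor_expr I J K R' n I J dA 3 cA.
Let EB := @factor_expr I J K R' n J I dB 4 cB.
Let leaf := solve_last 5 EA EB (khatri_rao_expr EA EB) (unfolding_expr I J K).

Lemma leaf_solution (s : store F) (X : 'M[F]_(R', K)) :
  eval T s (khatri_rao_expr EA EB) *m X = eval T s (unfolding_expr I J K) ->
  guaranteed T Q (Return EA EB (Tr (Reg I J K R' K 5))) (update s 5 X).
Proof.
move=> /unfolding_solution E; apply: cpd_of_polyadic R'R _; rewrite [LHS]E.
by rewrite [eval _ _ (Tr _)]/= update_same.
Qed.

(** Whatever was guessed, a solution of the last system gives a decomposition with at most [R]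
    terms, which is a CPD by minimality. The safety of all stages rests on this. *)
Lemma leaf_safe : safe 5 leaf.
Proof.
move=> s q rq s' ag; split=> [X /leaf_solution //|_].
exact: rq.
Qed.

End Leaf.

Lemma factors_safe R' n dA dB : (R' <= R)%N -> safe 5 (@factors_stage I J K R' n dA dB).
Proof. by move=> R'R; do 2!apply: search_safe => ?; apply: leaf_safe. Qed.

Lemma rays_safe R' k n M : (R' <= R)%N -> safe 3 (@rays_stage I J K R' k n M).
Proof.
move=> R'R; do 4!apply: search_safe => ?.
by do 2!apply: with_kernel_safe; apply: factors_safe.
Qed.

Lemma pencil_safe R' k n Phi c0 c1 d : (R' <= R)%N ->
  safe 1 (@pencil_stage I J K R' k n Phi c0 c1 d).
Proof.
by move=> R'R; do 2!apply: search_safe => ?; apply: with_eigenvectors_safe; apply: rays_safe.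
Qed.

Lemma attempt_safe R' k n : (R' <= R)%N -> safe 0 (@attempt I J K R' k n).
Proof.
by move=> R'R; do 4!apply: search_safe => ?; apply: with_kernel_safe; apply: pencil_safe.
Qed.

Lemma leaf_good n dA dB (cA : {ffun 'I_R -> 'I_dA}) (cB : {ffun 'I_R -> 'I_dB}) (s : store F) :
  (forall r, exists2 a, a != 0 &
     ray_part (N := #|lines R n|) (J := J) (s _ dA 3) r (cA r) = a *: col r A) ->
  (forall r, exists2 b, b != 0 &
     ray_part (N := #|lines R n|) (J := I) (s _ dB 4) r (cB r) = b *: col r B) ->
  good 5 s (@factors_stage I J K R n dA dB).
Proof.
move=> rayA rayB; apply: (search_good (x := cA)) => [?|].
  by apply: search_safe => ?; apply: leaf_safe.
apply: (search_good (x := cB)) => [?|]; first exact: leaf_safe.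
move=> q s' ag; split=> [X /leaf_solution|nosol]; first by apply.
have /fin_all_exists[a aP] : forall r, exists a, a != 0 /\
    col r (eval T s' (@factor_expr I J K R n I J dA 3 cA)) = a *: col r A.
  by move=> r; have [a a0 E] := rayA r; exists a; rewrite eval_factor ag.
have /fin_all_exists[b bP] : forall r, exists b, b != 0 /\
    col r (eval T s' (@factor_expr I J K R n J I dB 4 cB)) = b *: col r B.
  by move=> r; have [b b0 E] := rayB r; exists b; rewrite eval_factor ag.
(* The third factor absorbs the scalars of the other two. *)
case: (nosol (\matrix_(r, l) (C l r / (a r * b r)))); apply/unfolding_solution.
apply/ffunP => -[[i j] l]; rewrite !polyadicE; apply: eq_bigr => r _.
have [a0 /matrixP/(_ i 0)] := aP r; rewrite [LHS]mxE [RHS]mxE [X in _ * X]mxE => ->.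
have [b0 /matrixP/(_ j 0)] := bP r; rewrite [LHS]mxE [RHS]mxE [X in _ * X]mxE => ->.
rewrite !mxE; field; exact/andP.
Qed.

Local Notation n := (excess C).
Local Notation k := (krank C).
Local Notation N := #|lines R n|.
Local Notation Np := #|{: {ffun 'I_k -> 'I_n.+3}}|.
Let q (p : 'I_Np) : 'rV[F]_k := map_mx intr (grid p).

Section Projected.
Variable Phi : 'M[int]_(k, K).
Let C0 : 'M[F]_(k, R) := map_mx intr Phi *m C.
Hypothesis gpC0 : general_position C0.
Variable pt : {set 'I_R} -> 'rV[F]_k.
Hypothesis ptP :
  forall V : {set 'I_R}, #|V| = n.+1 -> forall r, ((pt V *m C0) 0 r == 0) = (r \notin V).

Lemma contract_projected (x : 'rV[F]_k) :
  contract T (x *m map_mx intr Phi) = core A B (x *m C0).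
Proof. by rewrite contract_polyadic mulmxA. Qed.

(** The right guess for [S] is the incidence [r \in V j]; [common_rays] then applies to [A] and,
    after transposition, to [B]. *)
Lemma rays_good (s : store F) (M : ('I_N -> 'I_k) -> 'I_N -> expr I J K I J)
    (i : {ffun 'I_N -> 'I_k}) (V : 'I_N -> {set 'I_R}) (x : 'I_N -> 'rV[F]_k) :
  (forall s', agree 3 s s' -> forall j, eval T s' (M i j) = core A B (x j *m C0)) ->
  (forall j, #|V j| = n.+1) -> (forall W : {set 'I_R}, #|W| = n.+1 -> exists j, V j = W) ->
  (forall j r, ((x j *m C0) 0 r == 0) = (r \notin V j)) ->
  good 3 s (rays_stage M).
Proof.
have [Rkn k1 kB kAB [kA nR]] := krank_bounds kABC kBC.
move=> ME Vn V_onto xV.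
pose S := [set rj : 'I_R * 'I_N | rj.1 \in V rj.2].
pose MA j := core A B (x j *m C0); pose MB j := core B A (x j *m C0).
have supp0 j r : r \notin V j -> (x j *m C0) 0 r = 0 by rewrite -xV => /eqP.
have suppV j : [set r | ((x j *m C0) 0 r != 0)%R] = V j.
  by apply/setP => r; rewrite inE xV negbK.
have rkA j : (#|[set r | ((x j *m C0) 0 r != 0)%R]| <= \rank (MA j))%N.
  by rewrite /MA; apply: leq_trans (rank_core_min kB kAB _); rewrite suppV Vn; lia.
have subA j (y : 'cV[F]_J) :
    exists2 z : 'cV[F]_R, (forall r, r \notin V j -> z r 0 = 0) & MA j *m y = A *m z.
  by have [z zV zE] := core_mul_supp A B (x j *m C0) y; exists z => // r /supp0/zV.
have subB j (y : 'cV[F]_I) :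
    exists2 z : 'cV[F]_R, (forall r, r \notin V j -> z r 0 = 0) & MB j *m y = B *m z.
  by have [z zV zE] := core_mul_supp B A (x j *m C0) y; exists z => // r /supp0/zV.
have supA j r : r \in V j -> exists y : 'cV[F]_J, col r A = MA j *m y.
  by move=> rV; apply: col_in_core; rewrite ?xV ?rV.
have supB j r : r \in V j -> exists y : 'cV[F]_I, col r B = MB j *m y.
  move=> rV; apply: col_in_core; last by rewrite xV rV.
  by rewrite -core_tr mxrank_tr.
have [dA [XA0 XA0P]] := orth_compl_exists (ray_system MA S).
have [dB [XB0 XB0P]] := orth_compl_exists (ray_system MB S).
have R'R := leqnn R.
apply: (search_good (x := i)) => [?|].
  by do 3!apply: search_safe => ?; do 2!apply: with_kernel_safe; apply: factors_safe.
apply: (search_good (x := S)) => [?|].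
  by do 2!apply: search_safe => ?; do 2!apply: with_kernel_safe; apply: factors_safe.
apply: (search_good (x := dA)) => [?|].
  by apply: search_safe => ?; do 2!apply: with_kernel_safe; apply: factors_safe.
apply: (search_good (x := dB)) => [?|].
  by do 2!apply: with_kernel_safe; apply: factors_safe.
apply: with_kernel_good => s1 ag1.
have -> : eval T s1 (ray_expr (M i) S) = ray_system MA S.
  by rewrite eval_ray; apply: eq_ray_system => j; rewrite ME.
split=> [|XA XAP]; first by exists XA0.
apply: with_kernel_good => s2 ag2.
have -> : eval T s2 (ray_expr (fun j => Tr (M i j)) S) = ray_system MB S.
  rewrite eval_ray; apply: eq_ray_system => j /=; rewrite ME ?core_tr //.
  apply: agree_trans ag1 (agree_trans (agree_update s1 XA (leqnn 3)) _).
  exact: agree_weak ag2.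
split=> [|XB XBP]; first by exists XB0.
have [XAS _ _] := XAP; have [XBS _ _] := XBP.
have [cA cAP] := common_rays nR kA V_onto subA supA XAS (fun z => orth_compl_full XAP).
have [cB cBP] := common_rays nR kB V_onto subB supB XBS (fun z => orth_compl_full XBP).
apply: (leaf_good (cA := cA) (cB := cB)) => r.
  by rewrite /update /= -/(update _ _ _) ag2 // update_same.
by rewrite update_same.
Qed.

(** The conditions on [c0] and [c1] make the eigenvalues distinct, so any eigenvectors yield the
    lines [pt V], in an unknown order [sg]. *)
Lemma pencil_good (s : store F) d (c0 c1 : 'cV[int]_k) :
  let L := s Np d 0 in
  (forall i, minor_kernel n A B C0 q (col i L)) ->
  (forall l, minor_kernel n A B C0 q l -> exists y, l = L *m y) ->
  (forall j : 'I_N, line_values n pt (map_mx intr c0) 0 j != 0) ->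
  (forall i j : 'I_N, i != j ->
     line_values n pt (map_mx intr c1) 0 i * line_values n pt (map_mx intr c0) 0 j !=
     line_values n pt (map_mx intr c1) 0 j * line_values n pt (map_mx intr c0) 0 i) ->
  good 1 s (@pencil_stage I J K R k n Phi c0 c1 d).
Proof.
have [Rkn k1 kB kAB [kA nR]] := krank_bounds kABC kBC.
move=> L LK Lfull D00 D01.
have qP x : exists l : 'I_Np -> F, forall g, is_form n.+2 g -> g x = \sum_p l p * g (q p).
  have [l lP] := grid_functional n.+2 x; exists (fun p => l (enum_val p)) => g /lP ->.
  rewrite (big_enum_val (fun p => l p * g (\row_a (p a)%:R))).
  apply: eq_bigr => p _; congr (_ * g _); apply/rowP => a.
  by rewrite !mxE rmorph_nat.
have [Mu Mu_free LE] := pencil_factor gpC0 Rkn k1 kB kAB ptP qP LK Lfull.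
have H_inj := point_monomials_inj ptP.
have [f [g [Hf Mug]]] := select_minor H_inj Mu_free.
apply: (search_good (x := f)) => [?|].
  by apply: search_safe => ?; apply: with_eigenvectors_safe; apply: rays_safe.
apply: (search_good (x := g)) => [?|].
  by apply: with_eigenvectors_safe; apply: rays_safe.
apply: with_eigenvectors_good => s1 ag1.
have evalE c : eval T s1 (sub_expr f g (pencil_expr I J K n d c)) =
    mxsub f g (point_monomials n pt *m diag_mx (line_values n pt (map_mx intr c)) *m Mu).
  by apply/matrixP => a b; rewrite eval_build eval_entry eval_pencil ag1 // LE [RHS]mxE.
rewrite !evalE; split=> [|X e [_ Xu XE]].
  have [X [e [Xu XE]]] := pencil_eigenvectors (point_monomials n pt)
    (line_values n pt (map_mx intr c1)) D00 f Mug.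
  by exists X, e; split=> //; apply: pencil_unit.
have [sg [sg_onto sgP]] := eigenvectors_pencil D00 D01 Hf Mug Xu XE.
have [i0 i0P] : exists i0 : {ffun 'I_N -> 'I_k}, forall j, pt (line (sg j)) 0 (i0 j) != 0.
  suff /fin_all_exists[i0 i0P] : forall j, exists i, pt (line (sg j)) 0 i != 0.
    by exists [ffun j => i0 j] => j; rewrite ffunE.
  move=> j; apply/existsP; apply: contraT; rewrite negb_exists => /forallP p0.
  have /card_gt0P[r rV] : (0 < #|line (sg j)|)%N by rewrite card_line.
  have := ptP (card_line (sg j)) r; rewrite rV.
  have -> : pt (line (sg j)) = 0.
    by apply/rowP => i; rewrite mxE; apply/eqP; have := p0 i; rewrite negbK.
  by rewrite mul0mx mxE eqxx.
have /fin_all_exists[b bP] : forall j, exists b, b != 0 /\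
    \row_a (colsub g (pencil_mx n q L (map_mx intr c0)) *m X) (ray_index n (i0 j) a) j =
    b *: pt (line (sg j)).
  move=> j; have [a a0 aE] := sgP j.
  (* The scale of the eigenvector times the common factor of the chosen monomials. *)
  exists (a * pt (line (sg j)) 0 (i0 j) ^+ n); split.
    by rewrite mulf_neq0 // expf_neq0.
  apply/rowP => l; rewrite mxE [RHS]mxE LE.
  have /matrixP/(_ (ray_index n (i0 j) l) 0) := aE; rewrite [LHS]mxE => ->.
  rewrite [LHS]mxE [X in _ * X]mxE [X in _ * X]mxE /ray_index enum_rankK mono_ray.
  by rewrite [RHS]mulrAC mulrA.
have evalM s' : agree 3 (update (update s1 1 X) 2 e) s' -> forall j,
    eval T s' (line_slice I J Phi c0 g i0 j) = core A B (b j *: pt (line (sg j)) *m C0).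
  move=> ag j; rewrite eval_line_slice.
  have -> : s' Np d 0 = L by rewrite ag // [LHS]ag1.
  have -> : s' N N 1 = X by rewrite ag // [LHS]update_same.
  by have [_ ->] := bP j; rewrite contract_projected.
apply: (@rays_good _ _ i0 (fun j => line (sg j)) (fun j => b j *: pt (line (sg j)))).
- exact: evalM.
- by move=> j; apply: card_line.
- by move=> W /line_onto[v <-]; have [j <-] := sg_onto v; exists j.
- move=> j r; have [b0 _] := bP j.
  by rewrite -scalemxAl mxE mulf_eq0 (negPf b0) ptP // card_line.
Qed.

End Projected.

Lemma map_vandermonde t : map_mx intr (vandermonde int K t : 'M_(k, K)) = vandermonde F K t.
Proof. by apply/matrixP => a b; rewrite !mxE rmorphXn rmorph_nat. Qed.

Lemma linf_moment t (x : 'rV[F]_k) :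
  linf (map_mx intr (moment int k t)^T) x = (moment F k t *m x^T) 0 0.
Proof.
rewrite /linf -[_ *m _]trmxK trmx_mul mxE; congr ((_ *m _) _ _).
by apply/rowP => a; rewrite !mxE rmorphXn rmorph_nat.
Qed.

Lemma attempt_good (s : store F) : good 0 s (@attempt I J K R k n).
Proof.
have [Rkn k1 kB kAB [kA nR]] := krank_bounds kABC kBC.
have [t gp] := gp_projection (leqnn k).
pose Phi := vandermonde int K (val \o t).
have PhiE : map_mx intr Phi = vandermonde F K (val \o t) by apply: map_vandermonde.
have gpC0 : general_position (map_mx intr Phi *m C) by rewrite PhiE.
have [pt ptP] := gp_points gpC0 Rkn (ltnW k1).
pose p (j : 'I_N) := pt (line j).
have [|t0 t0P] := @moment_avoid F _ xpredT _ (fun j : 'I_N => (p j)^T).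
  move=> j _; have /card_gt0P[r rV] : (0 < #|line j|)%N by rewrite card_line.
  apply: contraTneq rV => p0; rewrite -(ptP _ (card_line j)) -/(p j).
  by rewrite -[p j]trmxK p0 trmx0 mul0mx mxE.
pose l0 j := (moment F k t0 *m (p j)^T) 0 0.
(* Equality of the eigenvalues [i] and [j] is a linear condition on [c1]; it is nontrivial because
   the two points are not proportional. *)
have [|t1 t1P] := @moment_avoid F _ (fun ij : 'I_N * 'I_N => ij.1 != ij.2) _
    (fun ij => l0 ij.2 *: (p ij.1)^T - l0 ij.1 *: (p ij.2)^T).
  case=> i j /= ij; apply: contraNneq ij => /eqP.
  rewrite subr_eq0 -!linearZ => /eqP/trmx_inj pij.
  apply/eqP/enum_val_inj; rewrite -[enum_val i]/(line i) -[enum_val j]/(line j).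
  apply/setP => r; apply: negb_inj; rewrite -!(ptP _ (card_line _)) -/(p i) -/(p j).
  have := congr1 (fun x : 'rV_k => (x *m (map_mx intr Phi *m C)) 0 r == 0) pij.
  rewrite /= -!scalemxAl [in LHS]mxE [in RHS]mxE !mulf_eq0.
  by rewrite (negPf (t0P i isT)) (negPf (t0P j isT)).
pose G : 'M[F]_(Np, _) := \matrix_(x, fg) \det (mxsub
    (enum_val (fg : 'I_#|{: {ffun 'I_n.+2 -> 'I_I} * {ffun 'I_n.+2 -> 'I_J}}|)).1 (enum_val fg).2
    (core A B (q x *m (map_mx intr Phi *m C)))).
have [d [X0 X0P]] := orth_compl_exists G.
have kerG (l : 'cV[F]_Np) : minor_kernel n A B (map_mx intr Phi *m C) q l <-> G^T *m l = 0.
  split=> [lK | H f g].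
    apply/colP => fg; rewrite [RHS]mxE -[RHS](lK (enum_val fg).1 (enum_val fg).2) mxE.
    by apply: eq_bigr => x _; rewrite [G^T _ _]mxE [G _ _]mxE.
  have /matrixP/(_ (enum_rank (f, g)) 0) := H; rewrite [RHS]mxE => E.
  rewrite -[RHS]E mxE; apply: eq_bigr => x _.
  by rewrite [G^T _ _]mxE [G _ _]mxE enum_rankK.
have R'R := leqnn R.
apply: (search_good (x := t)) => [?|].
  by do 3!apply: search_safe => ?; apply: with_kernel_safe; apply: pencil_safe.
apply: (search_good (x := t0)) => [?|].
  by do 2!apply: search_safe => ?; apply: with_kernel_safe; apply: pencil_safe.
apply: (search_good (x := t1)) => [?|].
  by apply: search_safe => ?; apply: with_kernel_safe; apply: pencil_safe.
apply: (search_good (x := d)) => [?|].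
  by apply: with_kernel_safe; apply: pencil_safe.
apply: with_kernel_good => s1 _.
have -> : eval T s1 (minors_expr I J n Phi) = G.
  by apply/matrixP => x fg; rewrite eval_minors contract_projected mxE.
split=> [|X XP]; first by exists X0.
have [GX _ _] := XP.
apply: (pencil_good gpC0 ptP); rewrite ?update_same.
- by move=> i; apply/kerG; rewrite colE mulmxA GX mul0mx.
- by move=> l /kerG; apply: orth_compl_full XP.
- by move=> j; rewrite mxE linf_moment; apply: t0P.
- move=> i j ij; rewrite !mxE !linf_moment -subr_eq0.
  have := t1P (i, j) ij; rewrite mulmxBr -!scalemxAr [X in X != 0 -> _]mxE.
  rewrite [X in X + _ != 0 -> _]mxE [X in _ + X != 0 -> _]mxE [X in _ - X != 0 -> _]mxE.
  by rewrite mulrC [X in _ - X]mulrC.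
Qed.

End Guarantee.

(* The number of terms is tried in increasing order, so that the first
   decomposition found is minimal. *)
Definition cpd_procedure I J K : procedure I J K :=
  foldr (fun R : nat => search (fun k : 'I_K.+1 => @attempt I J K R k (R - k)))
    (Return (Const I J K 0 : expr I J K I 0) (Const I J K 0) (Const I J K 0))
    (iota 0 (I + K).+1).

Lemma cpd_procedure_finds (F : realType) I J K R
    (A : 'M[F]_(I, R)) (B : 'M[F]_(J, R)) (C : 'M[F]_(K, R)) :
  (2 * R + 2 <= krank A + \rank B + krank C)%N ->
  (R + 2 <= krank B + krank C)%N ->
  finds_cpd (cpd_procedure I J K) (polyadic A B C).
Proof.
move=> kABC kBC; rewrite /finds_cpd /cpd_procedure; set T := polyadic A B C.
(* As [\rank B <= R], the first hypothesis gives [R + 2 <= krank A + krank C], and a k-rank is at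
   most the number of rows. *)
have RIK : (R <= I + K)%N.
  by have := rank_leq_col B; have := krank_leq_row A; have := krank_leq_row C; lia.
have kK : (krank C < K.+1)%N by rewrite ltnS krank_leq_row.
have -> : iota 0 (I + K).+1 = iota 0 R ++ R :: iota R.+1 (I + K - R).
  by rewrite -[(I + K).+1](_ : (R + (I + K - R).+1)%N = _) ?iotaD //; lia.
rewrite foldr_cat /=; set p := search _ _.
pose Q N (A' : 'M[F]_(I, N)) (B' : 'M[F]_(J, N)) (C' : 'M[F]_(K, N)) := is_cpd T A' B' C'.
have rp : robust T Q 0 (empty_store F) p.
  apply: (search_good (x := Ordinal kK)) => [k|].
    exact: attempt_safe kABC kBC _ _ _ (leqnn R).
  exact: attempt_good kABC kBC _.
(* Trials with fewer than [R] terms come first and are safe. *)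
suff : robust T Q 0 (empty_store F) (foldr (fun R : nat =>
    search (fun k : 'I_K.+1 => @attempt I J K R k (R - k))) p (iota 0 R)).
  by apply; apply: agree_refl.
have : all (fun R' => R' <= R)%N (iota 0 R).
  by apply/allP => R'; rewrite mem_iota => /andP[_ /ltnW].
elim: (iota 0 R) => //= R' l IH /andP[R'R /IH]; apply: search_safe => k.
exact: attempt_safe kABC kBC _ _ _ R'R.
Qed.

Theorem corollary1p8 (F : realType) (I J K : nat) :
  exists p : procedure I J K,
  forall (R : nat) (A : 'M[F]_(I, R)) (B : 'M[F]_(J, R)) (C : 'M[F]_(K, R)),
    (2 * R + 2 <= krank A + \rank B + krank C)%N ->
    (R + 2 <= krank B + krank C)%N ->
    let T := polyadic A B C in
    [/\ has_tensor_rank T R, cpd_unique T & finds_cpd p T].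
Proof.
exists (cpd_procedure I J K) => R A B C kABC kBC; split.
- exact: tensor_rank.
- exact: unique_cpd.
- exact: cpd_procedure_finds.
Qed.
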